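(* Let $n_{\max}$ be the maximum number of generators that can contribute to the power generation at any time, and let $\Sigma_{n_{\max}}$ be the set of weighted digraphs that are strongly connected and weight-balanced and whose vertex set is included in $\{1,\dots,n_{\max}\}$. Let $\sigma:[0,\infty)\to\Sigma_{n_{\max}}$ be a piecewise constant, right-continuous switching signal described by the set of switching times $\{t_1,t_2,\dots\}\subset\mathbb{R}_{\ge0}$, with $t_k\le t_{k+1}$, each corresponding to either an addition or a deletion event. Consider the switching dynamics $$\dot P\in-\mathsf{L}(\sigma(t))\,\partial f^\epsilon(P)+\nu_1z,\qquad \dot z=-\alpha z-\beta\mathsf{L}(\sigma(t))z-v+\nu_2(P_le_r-P),\qquad \dot v=\alpha\beta\mathsf{L}(\sigma(t))z,$$ with $\alpha,\beta,\nu_1,\nu_2>0$, for the generators in $\sigma(t)$, initialized with $\mathbf{1}^\top v(0)=0$, and assume the units execute the TRAJECTORY INVARIANCE routine (see context) when they leave or join the network. Then: (i) at any time $t\in\{0\}\cup\{t_1,t_2,\dots\}$, if the variables $(P(t),z(t))$ of the generators in $\sigma(t)$ satisfy $|\mathbf{1}^\top P(t)-P_l|\le M_1$ and $|\mathbf{1}^\top z(t)|\le M_2$ for some $M_1,M_2>0$, then the magnitude $|\mathbf{1}^\top P-P_l|$ of the mismatch between generation and load becomes less than or equal to $\rho>0$ in time $$t_\rho=\frac{1}{c_2}\ln\Big(\frac{c_1(M_1+\nu_1M_2)}{\rho}\Big),$$ provided no event occurs in the interval $(t,t+t_\rho)$. Here $c_1=\sqrt{\lambda_{\max}(R)/\lambda_{\min}(R)}$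 and $c_2=\frac{1}{2\lambda_{\max}(R)}$ with $$R=\frac{1}{2\alpha\nu_1\nu_2}\begin{bmatrix}\alpha^2+\nu_1\nu_2+(\nu_1\nu_2)^2&\alpha\\ \alpha&1+\nu_1\nu_2\end{bmatrix};$$ (ii) if the number of events is finite, say $N$, then the trajectories of the switching dynamics converge to the set of solutions of the economic dispatch problem for the group of generators in $\sigma(t_N)$ (i.e., the power allocation $P(t)$ converges to this set), provided that $$\frac{\nu_1}{\beta\nu_2\lambda_2(\mathsf{L}+\mathsf{L}^\top)}+\frac{\nu_2^2\lambda_{\max}(\mathsf{L}^\top\mathsf{L})}{2\alpha}<\lambda_2(\mathsf{L}+\mathsf{L}^\top)$$ holds for $\mathsf{L}=\mathsf{L}(\sigma(t_N))$.
   Context: Notation: $\mathbf{1}$ is the all-ones vector of the dimension given by the number of units currently in the network; $[u]^+=\max\{0,u\}$; vector inequalities are componentwise; $e_r$ is the unit vector of the coordinate $r$, where $r$ is an (arbitrary) unit of the current network, the only one that knows the load $P_l\in\mathbb{R}_{>0}$; $\lambda_{\min},\lambda_{\max}$ are extreme eigenvalues of a symmetric matrix, and $\lambda_2(\mathsf{L}+\mathsf{L}^\top)$ is the smallest nonzero eigenvalue of $\mathsf{L}+\mathsf{L}^\top$. Graphs. A weighted digraph has a vertex set, an edge set and an adjacency matrix $\mathsf{A}=(a_{ij})$ with nonnegative entries, $a_{ij}>0$ iff $(i,j)$ is an edge. Its Laplacian is $\mathsf{L}=\mathsf{D}_{\rm out}-\mathsf{A}$, with $\mathsf{D}_{\rm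 out}$ diagonal and $(\mathsf{D}_{\rm out})_{ii}=\sum_ja_{ij}$; it is weight-balanced if $\sum_ja_{ij}=\sum_ja_{ji}$ for all $i$. The in-neighbors of $i$ are $\mathcal{N}^{\rm in}(i)=\{w\mid (w,i)\text{ is an edge}\}$. $\mathsf{L}(\sigma(t))$ is the Laplacian of $\sigma(t)$. Events. At any time $t$ the state consists of triples $(P_i,z_i,v_i)\in\mathbb{R}^3$, one for each unit $i$ in the vertex set of $\sigma(t)$. A deletion event removes a vertex and its adjacent edges (the unit's state variables disappear); an addition event adds a vertex (with its state variables) along with a set of edges. Between events the state evolves as a solution (absolutely continuous, satisfying the inclusion for almost all $t$) of the switching dynamics. TRAJECTORY INVARIANCE routine: when a unit $i$ joins the network at time $t$, it starts with $v_i(t)=0$; when a unit $i$ leaves the network at time $t$, it passes a token with value $v_i(t)$ to one of its in-neighbors $j\in\mathcal{N}^{\rm in}(i)$, which resets its value to $v_j(t)+v_i(t)$. Economic dispatch (ED) problem for a group $V$ of generators: each unit $i$ has a convex, continuously differentiable cost $f_i:\mathbb{R}\to\mathbb{R}_{\ge0}$ and limits $P_i^m,P_i^M\in\mathbb{R}$; the problem is to minimize $f(P)=\sum_{i\in V}f_i(P_i)$ subject to $\mathbf{1}^\top P=P_l$ and $P^m\le P\le P^M$. Its feasible set $\mathcal{F}_{\mathrm{ED}}$ is assumed nonempty, with neither $P^m$ nor $P^M$ feasible. The penalized cost is $f^\epsilon(P)=\sum_{i\in V}\big(f_i(P_i)+\frac1\epsilon([P_i-P_i^M]^++[P_i^m-P_i]^+)\big)$,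 with $V$ the vertex set of the current network, $\partial f^\epsilon$ is its (Clarke) generalized gradient, and $\epsilon>0$ satisfies $\epsilon<\frac{1}{2\max_{P\in\mathcal{F}_{\mathrm{ED}}}\|\nabla f(P)\|_\infty}$ for each group of generators arising along $\sigma$. Convergence to a set means that the distance to it tends to $0$. *)

(* Defs.v *)
From HB Require Import structures.
From mathcomp Require Import all_boot all_order all_algebra.
From mathcomp Require Import all_classical all_reals all_analysis.

Set Implicit Arguments.
Unset Strict Implicit.
Unset Printing Implicit Defensive.

Import Order.TTheory GRing.Theory Num.Theory.
Import numFieldNormedType.Exports.

Local Open Scope classical_set_scope.
Local Open Scope ring_scope.

(* The adjacency matrix is indexed by all of 'I_n and vanishes outside the
   vertex set; (i, j) is an edge iff the entry (i, j) is positive. *)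
Record wdigraph (R : realType) (n : nat) := Wdigraph {
  vertices : {set 'I_n};
  adj : 'M[R]_n;
  adj_ge0 : forall i j, 0 <= adj i j;
  adj_vertices : forall i j, 0 < adj i j -> (i \in vertices) && (j \in vertices)
}.

Definition edge (R : realType) (n : nat) (G : wdigraph R n) : rel 'I_n :=
  fun i j => 0 < adj G i j.

Definition strongly_connected (R : realType) (n : nat) (G : wdigraph R n) :=
  forall i j, i \in vertices G -> j \in vertices G -> connect (edge G) i j.

Definition weight_balanced (R : realType) (n : nat) (G : wdigraph R n) :=
  forall i, i \in vertices G ->
    \sum_(j in vertices G) adj G i j = \sum_(j in vertices G) adj G j i.

(* Vectors and matrices of a network with vertex set V have size #|V|, with
   coordinates enumerated by enum_val. *)
Definition restr (R : realType) (n : nat) (V : {set 'I_n}) (x : 'I_n -> R) :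
  'cV[R]_#|V| := \col_i x (enum_val i).

Definition ones (R : realType) (m : nat) : 'cV[R]_m := const_mx 1.

Definition sum_units (R : realType) (n : nat) (V : {set 'I_n}) (x : 'I_n -> R) : R :=
  ((ones R #|V|)^T *m restr V x) 0 0.

Definition adj_vert (R : realType) (n : nat) (G : wdigraph R n) :
    'M[R]_#|vertices G| :=
  \matrix_(i, j) adj G (enum_val i) (enum_val j).

Definition laplacian (R : realType) (n : nat) (G : wdigraph R n) :
    'M[R]_#|vertices G| :=
  diag_mx (\row_i \sum_j adj_vert G i j) - adj_vert G.

(* Extreme eigenvalues, used only for symmetric matrices of positive size, whose
   sets of eigenvalues are finite and nonempty.  For a matrix with no nonzero
   eigenvalue, lambda_two takes the value 0. *)
Definition lambda_max (R : realType) (m : nat) (A : 'M[R]_m) : R :=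
  sup [set l | eigenvalue A l].

Definition lambda_min (R : realType) (m : nat) (A : 'M[R]_m) : R :=
  inf [set l | eigenvalue A l].

Definition lambda_two (R : realType) (m : nat) (A : 'M[R]_m) : R :=
  inf [set l | eigenvalue A l /\ l != 0].

(* Clarke's generalized directional derivative
   limsup_(y -> x, h -> 0+) (F (y + h v) - F y) / h
   and generalized gradient. *)
Definition clarke_dir (R : realType) (m : nat) (F : 'cV[R]_m -> R)
    (x v : 'cV[R]_m) : \bar R :=
  limf_esup (fun p : 'cV[R]_m * R => ((F (p.1 + p.2 *: v) - F p.1) / p.2)%:E)
            (filter_prod (nbhs x) (0 : R)^'+).

Definition clarke_gradient (R : realType) (m : nat) (F : 'cV[R]_m -> R)
    (x : 'cV[R]_m) : set 'cV[R]_m :=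
  [set g | forall v, (((g^T *m v) 0 0)%:E <= clarke_dir F x v)%E].

Definition gradient (R : realType) (m : nat) (F : 'cV[R]_m -> R)
    (x : 'cV[R]_m) : 'cV[R]_m :=
  \col_i 'D_(delta_mx i 0) F x.

Definition pos_part (R : realType) (u : R) : R := Num.max 0 u.

Definition admissible_cost (R : realType) (f : R -> R) :=
  [/\ forall x, 0 <= f x,
      convex_function [set: convex_lmodType R^o] (f : R^o -> R^o),
      forall x, derivable f x 1
    & continuous (derive1 f)].

Definition ed_cost (R : realType) (n : nat) (f : 'I_n -> R -> R)
    (V : {set 'I_n}) (P : 'cV[R]_#|V|) : R :=
  \sum_i f (enum_val i) (P i 0).
Arguments ed_cost {R n} f V P.

Definition penalized_cost (R : realType) (n : nat) (f : 'I_n -> R -> R)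
    (Pm PM : 'I_n -> R) (eps : R) (V : {set 'I_n}) (P : 'cV[R]_#|V|) : R :=
  \sum_i (f (enum_val i) (P i 0)
          + 1 / eps * (pos_part (P i 0 - PM (enum_val i))
                       + pos_part (Pm (enum_val i) - P i 0))).
Arguments penalized_cost {R n} f Pm PM eps V P.

Definition ed_feasible (R : realType) (n : nat) (Pm PM : 'I_n -> R) (Pl : R)
    (V : {set 'I_n}) : set 'cV[R]_#|V| :=
  [set P | ((ones R #|V|)^T *m P) 0 0 = Pl /\
           forall i, Pm (enum_val i) <= P i 0 <= PM (enum_val i)].
Arguments ed_feasible {R n} Pm PM Pl V _.

Definition ed_solutions (R : realType) (n : nat) (f : 'I_n -> R -> R)
    (Pm PM : 'I_n -> R) (Pl : R) (V : {set 'I_n}) : set 'cV[R]_#|V| :=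
  [set P | ed_feasible Pm PM Pl V P /\
           forall Q, ed_feasible Pm PM Pl V Q -> ed_cost f V P <= ed_cost f V Q].
Arguments ed_solutions {R n} f Pm PM Pl V _.

(* The norm on 'cV[R]_m is the infinity norm.  The supremum is a maximum, the
   feasible set being compact.  The inverse is that of \bar R, so that the bound
   on eps is +oo when the gradient vanishes on the feasible set. *)
Definition ed_assumptions (R : realType) (n : nat) (f : 'I_n -> R -> R)
    (Pm PM : 'I_n -> R) (Pl eps : R) (V : {set 'I_n}) :=
  [/\ ed_feasible Pm PM Pl V !=set0,
      ~ ed_feasible Pm PM Pl V (restr V Pm),
      ~ ed_feasible Pm PM Pl V (restr V PM)
    & (eps%:E < (2 * sup [set `|gradient (ed_cost f V) P|
                         | P in ed_feasible Pm PM Pl V])%:E^-1)%E].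

(* Events are numbered 1, 2, ...; N is Some m when there are exactly m events
   and None when there are infinitely many.  The k-th event occurs at time
   tau k, and tau 0 = 0 is the initial time.  Phase k is the time between the
   k-th event and the next one; it may be reduced to a point, since several
   events may occur at the same time. *)
Definition occurs (N : option nat) (k : nat) : bool :=
  if N is Some m then (k <= m)%N else true.

Definition in_phase (R : realType) (N : option nat) (tau : nat -> R) (k : nat)
    (t : R) : bool :=
  [&& occurs N k, tau k <= t & occurs N k.+1 ==> (t < tau k.+1)].

Definition in_closed_phase (R : realType) (N : option nat) (tau : nat -> R)
    (k : nat) (t : R) : bool :=
  [&& occurs N k, tau k <= t & occurs N k.+1 ==> (t <= tau k.+1)].

Definition deletion (R : realType) (n : nat) (i : 'I_n) (G G' : wdigraph R n) :=
  [/\ i \in vertices G,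
      vertices G' = vertices G :\ i
    & forall j l, j \in vertices G' -> l \in vertices G' ->
        adj G' j l = adj G j l].

Definition addition (R : realType) (n : nat) (i : 'I_n) (G G' : wdigraph R n) :=
  [/\ i \notin vertices G,
      vertices G' = i |: vertices G
    & forall j l, edge G j l -> adj G' j l = adj G j l].

(* G k is the network after the first k events.  It is a value of sigma, hence
   strongly connected and weight-balanced, unless the (k+1)-st event is
   simultaneous with the k-th one. *)
Record switching_signal (R : realType) (n : nat) (sigma : R -> wdigraph R n)
    (N : option nat) (tau : nat -> R) (G : nat -> wdigraph R n) : Prop := {
  tau_start : tau 0%N = 0;
  tau_monotone : forall k, occurs N k.+1 -> tau k <= tau k.+1;
  tau_diverges : N = None -> tau k @[k --> \oo] --> +oo;
  signal_strong : forall t, 0 <= t -> strongly_connected (sigma t);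
  signal_balanced : forall t, 0 <= t -> weight_balanced (sigma t);
  signal_constant : forall k t, in_phase N tau k t -> sigma t = G k;
  signal_event : forall k, occurs N k.+1 ->
    (exists i, addition i (G k) (G k.+1)) \/
    (exists i, deletion i (G k) (G k.+1))
}.

Definition abs_continuous (R : realType) (W : normedModType R) (a b : R)
    (x : R -> W) :=
  forall e : R, 0 < e -> exists2 d : R, 0 < d &
    forall (m : nat) (u w : 'I_m -> R),
      (forall i, a <= u i /\ u i <= w i /\ w i <= b) ->
      (forall i j, i != j -> w i <= u j \/ w j <= u i) ->
      \sum_i (w i - u i) < d ->
      \sum_i `|x (w i) - x (u i)| < e.

(* A trajectory is given phase by phase: P k t i is the value of the variable of
   unit i at a time t of the k-th closed phase, so that P k (tau k.+1) is the
   value just before the next event.  The values for units outside the current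
   network are meaningless and never referred to. *)
Definition dynamics_at (R : realType) (n : nat)
    (F : forall V : {set 'I_n}, 'cV[R]_#|V| -> R)
    (Pl alpha beta nu1 nu2 : R) (G : wdigraph R n) (r : 'I_n)
    (P z v : R -> 'I_n -> R) (t : R) :=
  let V := vertices G in
  let L := laplacian G in
  let Pt := restr V (P t) in
  let zt := restr V (z t) in
  let vt := restr V (v t) in
  let er := restr V (fun i => (i == r)%:R) in
  exists2 g : 'cV[R]_#|V|, clarke_gradient (F V) Pt g &
    [/\ is_derive t 1 (fun s => restr V (P s)) (- (L *m g) + nu1 *: zt),
        is_derive t 1 (fun s => restr V (z s))
          (- (alpha *: zt) - beta *: (L *m zt) - vt + nu2 *: (Pl *: er - Pt))
      & is_derive t 1 (fun s => restr V (v s)) ((alpha * beta) *: (L *m zt))].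

Record solves_dynamics (R : realType) (n : nat)
    (F : forall V : {set 'I_n}, 'cV[R]_#|V| -> R)
    (Pl alpha beta nu1 nu2 : R) (sigma : R -> wdigraph R n) (N : option nat)
    (tau : nat -> R) (G : nat -> wdigraph R n) (r : nat -> 'I_n)
    (P z v : nat -> R -> 'I_n -> R) : Prop := {
  solution_ac : forall k T, in_closed_phase N tau k T ->
    [/\ abs_continuous (tau k) T (fun s => restr (vertices (G k)) (P k s)),
        abs_continuous (tau k) T (fun s => restr (vertices (G k)) (z k s))
      & abs_continuous (tau k) T (fun s => restr (vertices (G k)) (v k s))];
  solution_ae : forall k,
    {ae (@lebesgue_measure R), forall t, in_phase N tau k t ->
      dynamics_at F Pl alpha beta nu1 nu2 (sigma t) (r k) (P k) (z k) (v k) t}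
}.

(* The token of a leaving unit goes to an in-neighbor other than the unit
   itself, which matters if it has a self-loop. *)
Definition trajectory_invariance (R : realType) (n : nat) (N : option nat)
    (tau : nat -> R) (G : nat -> wdigraph R n) (P z v : nat -> R -> 'I_n -> R) :=
  forall k, occurs N k.+1 -> let t := tau k.+1 in
    (forall i, addition i (G k) (G k.+1) ->
       v k.+1 t i = 0 /\
       forall l, l \in vertices (G k) ->
         [/\ P k.+1 t l = P k t l, z k.+1 t l = z k t l & v k.+1 t l = v k t l])
    /\
    (forall i, deletion i (G k) (G k.+1) ->
       exists j, [/\ j != i, edge (G k) j i &
         forall l, l \in vertices (G k.+1) ->
           [/\ P k.+1 t l = P k t l, z k.+1 t l = z k t l
             & v k.+1 t l = if l == j then v k t j + v k t i else v k t l]]).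

Definition mismatch_matrix (R : realType) (alpha nu1 nu2 : R) : 'M[R]_(1 + 1) :=
  (1 / (2 * alpha * nu1 * nu2)) *:
  block_mx (alpha ^+ 2 + nu1 * nu2 + (nu1 * nu2) ^+ 2)%:M alpha%:M
           alpha%:M                                       (1 + nu1 * nu2)%:M.

(* Main.v *)
(* Summing the dynamics over the units, weight balance and the invariance of
   1^T v = 0 leave the linear system x1' = x2, x2' = - alpha x2 - nu1 nu2 x1 for
   x1 = 1^T P - Pl and x2 = nu1 1^T z; R solves its Lyapunov equation, whence the
   exponential decay of (i).

   For (ii), let xi = v + alpha z - nu2 (Pl e_r - P) and
   W = f^eps(P) + (nu1 nu2 |z|^2 + |xi|^2) / 2.  Along a solution with selected
   subgradient g, the gain condition and Young's inequality bound W' by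
   - kappa (|dev g|^2 + |dev z|^2 + |xi|^2) + nu1 (mean g) (1^T z), where dev removes
   the mean.  The last product is controlled: 1^T z decays exponentially, and since
   1^T P stays bounded, |mean g| <= C + |dev g|.  Hence W plus an exponentially small
   term decreases, and |dev g|, |dev z|, |xi| are simultaneously small at arbitrarily
   late times.  There the subgradient inequality at an optimal Q gives W <= f(Q) + small,
   and monotonicity propagates this to all later times.  So f^eps(P) has limsup at most
   the optimal cost while 1^T P -> Pl; by exactness of the penalty and compactness P
   approaches the set of solutions.  No invariance principle is needed. *)
Require Import Defs.
From mathcomp Require Import all_boot all_order all_algebra.
From mathcomp Require Import all_classical all_reals all_analysis.
From mathcomp Require Import measurable_realfun ring lra.
Import Order.TTheory GRing.Theory Num.Theory.
Import numFieldNormedType.Exports.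
Set Implicit Arguments.
Unset Strict Implicit.
Unset Printing Implicit Defensive.
Local Open Scope classical_set_scope.
Local Open Scope ring_scope.

(** * Absolutely continuous functions *)

(** The selected subgradient g is given only at almost every time, and nothing is known of its
    dependence on time, so W admits no chain rule. At a good time t the convex cost is compared
    instead with the linear function of the state defined by g. This bounds the increments of the
    cost up to t, which suffices for the monotonicity of an absolutely continuous function. That
    criterion is proved by a covering argument, not by integrating a derivative. The weights in W
    come from the choice of xi: xi' contains nu1 nu2 z and z' contains - xi, so weighting |z|^2 by
    nu1 nu2 cancels all products of z and xi. There remain the products of dev z with dev g and of
    xi with L g. Young's inequality charges both to |dev g|^2, and the two summands of the gain
    condition are these two charges. The spectral constants are defined as suprema and infima of
    sets of eigenvalues. The bounds on quadratic forms used in the estimates therefore have to be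
    derived, which is done by maximising over the unit sphere. *)

Lemma is_derive_left_bound (R : realType) (k : R -> R) (t d e : R) :
  is_derive t 1 k d -> d <= 0 -> 0 < e ->
  exists2 r : R, 0 < r &
    forall y, t - r < y -> y < t -> k t - k y <= e * (t - y).
Proof.
move=> [dk dkE] d0 e0.
have /cvgrPdist_lt /(_ e e0) : h^-1 *: ((k \o shift t) (h *: (1 : R)) - k t)
    @[h --> 0^'] --> d by rewrite -dkE; exact: dk.
move=> /nbhs_ballP[r r0 Hr]; exists r => // y ry yt.
have /= := Hr (y - t).
rewrite /ball/= sub0r normrN ltr0_norm ?subr_lt0// opprB.
have -> : (t - y < r) by lra.
move=> /(_ isT); have yt0 : y - t != 0 by rewrite subr_eq0 lt_eqF.
move=> /(_ yt0); rewrite /shift/= -[_ *: 1]/(_ * 1) mulr1 subrK.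
rewrite -[_ *: _]/(_ * _) => /ltr_distlCDr Hq.
have q0 : (y - t)^-1 * (k y - k t) <= e by lra.
have -> : k t - k y = ((y - t)^-1 * (k y - k t)) * (t - y).
  by rewrite -opprB -(opprB y t) mulrN -mulrA [_ * (y - t)]mulrC mulKf.
by apply: ler_wpM2r => //; lra.
Qed.

Lemma abs_continuous_near (R : realType) (W : normedModType R) (h : R -> W)
    (a b e : R) :
  abs_continuous a b h -> 0 < e ->
  exists2 d : R, 0 < d & forall y s, a <= s -> s <= y -> y <= b ->
    y - s < d -> `|h y - h s| < e.
Proof.
move=> ach e0; have [d d0 Hd] := ach e e0; exists d => // y s as_ sy yb ysd.
have := Hd 1%N (fun=> s) (fun=> y).
rewrite !big_ord1; apply => //.
by move=> i j; rewrite (ord1 i) (ord1 j) eqxx.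
Qed.

(** Outer regularity controls the measure of [U] minus a null set, and this is the measure of [U]
    itself. *)
Lemma negligible_open_cover (R : realType) (E : set R) (d : R) :
  (@lebesgue_measure R).-negligible E -> 0 < d ->
  exists U : set R, [/\ open U, E `<=` U & (lebesgue_measure U < d%:E)%E].
Proof.
move=> [A [mA A0 EA]] d0.
have Afin : (lebesgue_measure A < +oo)%E by rewrite A0.
have [U [oU AU UA]] := lebesgue_regularity_outer mA Afin d0.
exists U; split => //; first exact: subset_trans AU.
apply: le_lt_trans UA.
have mU : measurable U by exact: open_measurable.
have UA0 : (lebesgue_measure (U `&` A) = 0)%E.
  apply/eqP; rewrite -measure_le0 -[leRHS]A0; apply: le_measure; rewrite ?inE//.
  exact: measurableI.
have := measureDI (@lebesgue_measure R) mU mA.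
rewrite (_ : _ `&` _ = U `&` A)//= => ->.
by rewrite [X in (_ + X)%E]UA0 adde0.
Qed.

(* Only a left difference quotient is controlled.  This is what a convex function
   of the state provides: a subgradient at time t bounds its increments up to t,
   while no two-sided derivative is at hand. *)
Lemma abs_continuous_nonincreasing (R : realType) (h : R -> R) (a b : R) :
  a <= b -> abs_continuous a b (h : R -> R^o) ->
  {ae (@lebesgue_measure R), forall t, a < t < b ->
    exists k d, [/\ is_derive t (1 : R) (k : R -> R) d, d <= 0
      & forall y, a <= y -> y <= t -> h t - h y <= k t - k y]} ->
  h b <= h a.
Proof.
move=> ab ach aeh.
(* One of the two extra [e] will bound the increments over the intervals covering the exceptional
   set, the other is the tolerance [eta] of the family below. *)
suff main e : 0 < e -> h b - h a <= e * (b - a) + e + e.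
  rewrite -subr_le0; apply/ler_addgt0Pr => e e0; rewrite add0r.
  have c0 : 0 < b - a + 1 + 1 by lra.
  have := main (e / (b - a + 1 + 1)) (divr_gt0 e0 c0).
  move/le_trans; apply.
  rewrite (_ : _ + _ = e / (b - a + 1 + 1) * (b - a + 1 + 1)); last by ring.
  by rewrite divfK// gt_eqF.
move=> e0.
have [d d0 Hd] := ach e e0.
(* The hypothesis says nothing at [b], so [b] is added to the exceptional set. *)
have nE : (@lebesgue_measure R).-negligible
    (~` [set t | a < t < b -> exists k d, [/\ is_derive t (1 : R) (k : R -> R) d,
      d <= 0 & forall y, a <= y -> y <= t -> h t - h y <= k t - k y]] `|` [set b]).
  apply: negligibleU => //; exists [set b]; split => //.
  exact: lebesgue_measure_set1.
have [U [oU EU Ud]] := negligible_open_cover nE d0.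
have mU : measurable U by exact: open_measurable.
(* A sweep from [b] down to [a]. The increment of [h] over [[y, b]] is charged partly to slope [e],
   partly to finitely many disjoint intervals whose total length is paid for by the measure of [U]
   to the right of [y]. *)
pose fam y eta := exists (m : nat) (u w : 'I_m -> R),
  [/\ forall i, y <= u i /\ u i <= w i /\ w i <= b,
      forall i j, i != j -> w i <= u j \/ w j <= u i,
      ((\sum_i (w i - u i))%:E <= lebesgue_measure (U `&` `]y, b]%classic))%E
    & h b - h y <= e * (b - y) + \sum_i `|h (w i) - h (u i)| + eta].
pose S := [set y | a <= y <= b /\ forall eta, 0 < eta -> fam y eta].
have Sb : S b.
  split; first by rewrite ab lexx.
  move=> eta eta0; exists 0%N, (fun=> 0), (fun=> 0); split.
  - by case.
  - by case.
  - by rewrite big_ord0.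
  - by rewrite big_ord0 !subrr; lra.
have hlS : has_inf S.
  by split; [exists b | exists a => y [/andP[]]].
set s := inf S.
have as_ : a <= s by apply: lb_le_inf; [exists b | move=> y [/andP[]]].
have sb : s <= b by apply: ge_inf => //; case: hlS.
(* Points of [S] close to [s] give the bound at [s] up to a continuity error. The tolerance [eta]
   absorbs it: half goes to the family, half to the error. *)
have Ss : S s.
  split; first by rewrite as_ sb.
  move=> eta eta0.
  have eta2 : 0 < eta / 2 by rewrite divr_gt0.
  have [d1 d10 Hd1] := abs_continuous_near ach eta2.
  have [y Sy ysd] := inf_adherent d10 hlS; rewrite -/s in ysd.
  have sy : s <= y by apply: ge_inf => //; case: hlS.
  case: Sy => /andP[ay yb] /(_ _ eta2)[m [u [w [Huw Hdis Hmu Hh]]]].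
  exists m, u, w; split => //.
  - by move=> i; have [? ?] := Huw i; split => //; exact: le_trans sy _.
  - apply: (le_trans Hmu); apply: le_measure; rewrite ?inE.
    + by apply: measurableI => //; exact: measurable_itv.
    + by apply: measurableI => //; exact: measurable_itv.
    + move=> x [Ux]; rewrite /= !in_itv/= => /andP[yx ->].
      by split => //=; rewrite ?in_itv/= andbT (le_lt_trans sy).
  - have := Hd1 y s as_ sy yb; rewrite ltrBlDl => /(_ ysd).
    move=> /ltW /(le_trans (ler_norm _)) hys.
    have : e * (b - y) <= e * (b - s) by apply: ler_wpM2l; lra.
    lra.
have Sa : S a.
  have [<-//|nas] := eqVneq s a.
  have as' : a < s by rewrite lt_neqAle eq_sym nas.
  exfalso.
  suff [y Sy ys] : exists2 y, S y & y < s.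
    suff : s <= y by rewrite leNgt ys.
    by apply: ge_inf => //; case: hlS.
  (* The sweep cannot stop at [s > a]. If [s] lies in the open set [U], an interval [[y, s]] inside
     [U] joins the family; otherwise [s < b] is a good point and slope [e] covers a step to the
     left. *)
  have [Us|nUs] := pselect (U s).
    have /nbhs_ballP[r r0 Hr] : nbhs s U by exact: open_nbhs_nbhs.
    simpl in r0.
    pose y := Num.max a (s - r / 2).
    have ay : a <= y by rewrite le_max lexx.
    have ys : y < s by rewrite gt_max as'/=; lra.
    have ry : s - r < y by rewrite lt_max; apply/orP; right; lra.
    have yU x : y <= x -> x <= s -> U x.
      move=> yx xs; apply: Hr; rewrite /ball/= ger0_norm ?subr_ge0//; lra.
    exists y => //; split; first by rewrite ay/=; lra.
    move=> eta eta0.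
    case: Ss => _ /(_ _ eta0)[m [u [w [Huw Hdis Hmu Hh]]]].
    exists m.+1, (fun i => oapp u y (unlift ord0 i)),
      (fun i => oapp w s (unlift ord0 i)); split.
    - move=> i; case: unliftP => [j _|_] /=; last by repeat split; lra.
      by have [? [? ?]] := Huw j; repeat split => //; lra.
    - move=> i j; case: unliftP => [i' ->|->]; case: unliftP => [j' ->|->] //=.
      + by rewrite (inj_eq lift_inj); exact: Hdis.
      + by move=> _; right; case: (Huw i').
      + by move=> _; left; case: (Huw j').
    - rewrite big_ord_recl unlift_none/= (eq_bigr (fun i => w i - u i)); last first.
        by move=> i _; rewrite liftK.
      rewrite (_ : U `&` `]y, b] = `]y, s] `|` (U `&` `]s, b])); last first.
        apply/seteqP; split => x /=; rewrite !in_itv/=.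
          move=> [Ux /andP[yx xb]]; have [xs|sx] := leP x s.
            by left; rewrite yx.
          by right; rewrite xb.
        move=> [/andP[yx xs]|[Ux /andP[sx xb]]].
          by split; [apply: yU => //; exact: ltW | rewrite yx/=; lra].
        by split => //; rewrite xb andbT; lra.
      rewrite measureU//; last 2 first.
      + by apply: measurableI => //; exact: measurable_itv.
      + apply/seteqP; split => // x /=; rewrite !in_itv/= => -[/andP[_ xs]].
        by move=> [_ /andP[sx _]]; lra.
      rewrite EFinD; apply: leeD => //.
      by have := lebesgue_measure_itv `]y, s]; rewrite /= lte_fin ys EFinB => <-.
    - rewrite big_ord_recl unlift_none/= (eq_bigr (fun i => `|h (w i) - h (u i)|));
        last by move=> i _; rewrite liftK.
      have := ler_norm (h s - h y).
      have : 0 <= e * (s - y) by apply: mulr_ge0; lra.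
      lra.
  have /not_orP[/contrapT good nb] := (fun H => nUs (EU s H)).
  have /andP[_] : a < s < b.
    by rewrite as' lt_neqAle sb andbT; apply/eqP.
  move=> sb'.
  have [|k [dk [kd dk0 Hk]]] := good; first by rewrite as'.
  have [r r0 Hr] := is_derive_left_bound kd dk0 e0.
  pose y := Num.max a (s - r / 2).
  have ay : a <= y by rewrite le_max lexx.
  have ys : y < s by rewrite gt_max as'/=; lra.
  have ry : s - r < y by rewrite lt_max; apply/orP; right; lra.
  exists y => //; split; first by rewrite ay/=; lra.
  move=> eta eta0.
  case: Ss => _ /(_ _ eta0)[m [u [w [Huw Hdis Hmu Hh]]]].
  exists m, u, w; split => //.
  - by move=> i; have [? [? ?]] := Huw i; repeat split => //; lra.
  - apply: (le_trans Hmu); apply: le_measure; rewrite ?inE.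
    + by apply: measurableI => //; exact: measurable_itv.
    + by apply: measurableI => //; exact: measurable_itv.
    + move=> x [Ux]; rewrite /= !in_itv/= => /andP[yx ->].
      by split => //=; rewrite ?in_itv/= andbT; lra.
  - have := Hk y ay (ltW ys); have := Hr y ry ys; lra.
case: Sa => _ /(_ e e0)[m [u [w [Huw Hdis Hmu Hh]]]].
suff : \sum_i `|h (w i) - h (u i)| < e by lra.
apply: Hd => //.
rewrite -lte_fin; apply: (le_lt_trans Hmu); apply: le_lt_trans Ud.
apply: le_measure; rewrite ?inE//.
by apply: measurableI => //; exact: measurable_itv.
Qed.

Lemma abs_continuous_sub (R : realType) (W : normedModType R) (a b a' b' : R)
    (x : R -> W) :
  a <= a' -> b' <= b -> abs_continuous a b x -> abs_continuous a' b' x.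
Proof.
move=> aa bb acx e e0; have [d d0 Hd] := acx e e0; exists d => // m u w Huw.
apply: Hd => i; have [? [? ?]] := Huw i.
by split; [exact: le_trans aa _|split => //; exact: le_trans bb].
Qed.

Lemma abs_continuous_dominated (R : realType) (W W1 W2 : normedModType R)
    (a b K : R) (h : R -> W) (x : R -> W1) (y : R -> W2) :
  abs_continuous a b x -> abs_continuous a b y -> 0 < K ->
  (forall u w, a <= u -> u <= w -> w <= b ->
     `|h w - h u| <= K * (`|x w - x u| + `|y w - y u|)) ->
  abs_continuous a b h.
Proof.
move=> acx acy K0 hxy e e0.
have e2 : 0 < e / (2 * K) by rewrite divr_gt0// mulr_gt0.
have [d1 d10 Hd1] := acx _ e2; have [d2 d20 Hd2] := acy _ e2.
exists (Num.min d1 d2); first by rewrite lt_min d10.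
move=> m u w Huw Hdis; rewrite lt_min => /andP[l1 l2].
have h1 := Hd1 m u w Huw Hdis l1; have h2 := Hd2 m u w Huw Hdis l2.
apply: (@le_lt_trans _ _ (K * (\sum_i `|x (w i) - x (u i)| +
    \sum_i `|y (w i) - y (u i)|))).
  rewrite -big_split/= mulr_sumr; apply: ler_sum => i _.
  by have [? [? ?]] := Huw i; exact: hxy.
have -> : e = K * (e / (2 * K) + e / (2 * K)).
  by field; rewrite gt_eqF.
by rewrite ltr_pM2l// ltrD.
Qed.

Lemma abs_continuous_lipschitz (R : realType) (W W1 : normedModType R)
    (a b K : R) (h : R -> W) (x : R -> W1) :
  abs_continuous a b x -> 0 < K ->
  (forall u w, a <= u -> u <= w -> w <= b -> `|h w - h u| <= K * `|x w - x u|) ->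
  abs_continuous a b h.
Proof.
move=> acx K0 hx; apply: (abs_continuous_dominated acx acx K0) => u w au uw wb.
apply: le_trans (hx u w au uw wb) _; rewrite ler_pM2l//.
by rewrite lerDl.
Qed.

Lemma abs_continuous_id (R : realType) (a b : R) :
  abs_continuous a b (id : R -> R^o).
Proof.
move=> e e0; exists e => // m u w Huw _ /=; apply: le_lt_trans.
by apply: ler_sum => i _; have [? [? ?]] := Huw i; rewrite ger0_norm// subr_ge0.
Qed.

Lemma abs_continuous_cst (R : realType) (W : normedModType R) (a b : R) (c : W) :
  abs_continuous a b (fun=> c).
Proof.
apply: (abs_continuous_lipschitz (abs_continuous_id a b) ltr01) => u w _ _ _.
by rewrite subrr normr0 mul1r.
Qed.

Lemma abs_continuousD (R : realType) (a b : R) (x y : R -> R) :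
  abs_continuous a b (x : R -> R^o) -> abs_continuous a b (y : R -> R^o) ->
  abs_continuous a b ((fun s => x s + y s) : R -> R^o).
Proof.
move=> acx acy; apply: (abs_continuous_dominated acx acy ltr01) => u w _ _ _.
by rewrite mul1r opprD addrACA ler_normD.
Qed.

Lemma abs_continuous_sum (R : realType) (a b : R) (m : nat) (x : 'I_m -> R -> R) :
  (forall i, abs_continuous a b (x i : R -> R^o)) ->
  abs_continuous a b ((fun s => \sum_i x i s) : R -> R^o).
Proof.
elim: m x => [|m IH] x acx.
  rewrite (_ : (fun _ => _) = fun=> 0); first exact: abs_continuous_cst.
  by apply/funext => s; rewrite big_ord0.
rewrite (_ : (fun _ => _) = fun s => x ord0 s + \sum_i x (lift ord0 i) s).
  by apply: abs_continuousD => //; apply: IH.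
by apply/funext => s; rewrite big_ord_recl.
Qed.

Lemma abs_continuous_within (R : realType) (a b : R) (x : R -> R) :
  abs_continuous a b (x : R -> R^o) -> {within `[a, b], continuous x}.
Proof.
move=> acx; apply/subspace_continuousP => s; rewrite /= in_itv/= => /andP[as_ sb].
apply/cvgrPdist_lt => e e0.
have [d d0 Hd] := abs_continuous_near acx e0.
apply/nbhs_ballP; exists d => //= y; rewrite /ball/= => ysd.
rewrite in_itv/= => /andP[ay yb].
have [sy|ys] := leP s y.
  rewrite distrC; apply: Hd => //.
  by rewrite (le_lt_trans _ ysd)// distrC ler_norm.
apply: Hd => //; first exact: ltW.
by rewrite (le_lt_trans _ ysd)// ler_norm.
Qed.

Lemma abs_continuous_bounded (R : realType) (a b : R) (x : R -> R) :
  abs_continuous a b (x : R -> R^o) ->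
  exists2 K : R, 0 < K & forall s, a <= s -> s <= b -> `|x s| <= K.
Proof.
move=> acx; have [ba|ab] := ltP b a.
  by exists 1 => // s as_ sb; have := le_trans as_ sb; rewrite leNgt ba.
have acn : abs_continuous a b ((fun s => `|x s|) : R -> R^o).
  apply: (abs_continuous_lipschitz acx ltr01) => u w _ _ _.
  by rewrite mul1r; exact: ler_dist_dist.
have [c _ Hc] := EVT_max ab (abs_continuous_within acn).
exists (`|x c| + 1); first by rewrite ltr_wpDl.
move=> s as_ sb; apply: (@le_trans _ _ `|x c|); last by rewrite lerDl.
by apply: Hc; rewrite in_itv/= as_.
Qed.

Lemma abs_continuousM (R : realType) (a b : R) (x y : R -> R) :
  abs_continuous a b (x : R -> R^o) -> abs_continuous a b (y : R -> R^o) ->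
  abs_continuous a b ((fun s => x s * y s) : R -> R^o).
Proof.
move=> acx acy.
have [K1 K10 HK1] := abs_continuous_bounded acx.
have [K2 K20 HK2] := abs_continuous_bounded acy.
apply: (abs_continuous_dominated acx acy (addr_gt0 K10 K20)) => u w au uw wb.
have -> : x w * y w - x u * y u = (x w - x u) * y w + x u * (y w - y u) by ring.
apply: le_trans (ler_normD _ _) _; rewrite !normrM.
have xu : `|x u| <= K1 by apply: HK1 => //; exact: le_trans uw wb.
have yw : `|y w| <= K2 by apply: HK2 => //; exact: le_trans au uw.
have h1 : `|x w - x u| * `|y w| <= `|x w - x u| * K2 by rewrite ler_wpM2l.
have h2 : `|x u| * `|y w - y u| <= K1 * `|y w - y u| by rewrite ler_wpM2r.
have h3 : 0 <= `|x w - x u| * K1 by rewrite mulr_ge0// ltW.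
have h4 : 0 <= K2 * `|y w - y u| by rewrite mulr_ge0// ltW.
apply: (le_trans (lerD h1 h2)).
have : `|x w - x u| * K2 + K1 * `|y w - y u| <=
    (K1 + K2) * (`|x w - x u| + `|y w - y u|) by lra.
exact.
Qed.

Lemma abs_continuousZ (R : realType) (a b c : R) (x : R -> R) :
  abs_continuous a b (x : R -> R^o) ->
  abs_continuous a b ((fun s => c * x s) : R -> R^o).
Proof.
by apply: (@abs_continuousM _ a b (fun=> c)); exact: (@abs_continuous_cst _ R^o).
Qed.

Lemma abs_continuousB (R : realType) (a b : R) (x y : R -> R) :
  abs_continuous a b (x : R -> R^o) -> abs_continuous a b (y : R -> R^o) ->
  abs_continuous a b ((fun s => x s - y s) : R -> R^o).
Proof.
move=> acx acy; apply: (abs_continuous_dominated acx acy ltr01) => u w _ _ _.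
rewrite mul1r (_ : _ - _ = (x w - x u) - (y w - y u)); last by ring.
exact: ler_normB.
Qed.

Lemma expR_lipschitz (R : realType) (M p q : R) : p <= M -> q <= M ->
  `|expR p - expR q| <= expR M * `|p - q|.
Proof.
wlog qp : p q / q <= p.
  move=> H pM qM; have [qp|/ltW pq] := leP q p; first exact: H.
  by rewrite distrC (distrC p); exact: H.
move=> pM qM; rewrite !ger0_norm ?subr_ge0 ?ler_expR//.
have -> : expR p - expR q = expR p * (1 - expR (q - p)).
  by rewrite mulrBr mulr1 -expRD addrCA subrr addr0.
have h : 1 - expR (q - p) <= p - q by have := expR_ge1Dx (q - p); lra.
apply: (@le_trans _ _ (expR p * (p - q))).
  by rewrite ler_wpM2l// expR_ge0.
by rewrite ler_wpM2r ?subr_ge0// ler_expR.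
Qed.

Lemma abs_continuous_expR (R : realType) (a b : R) (x : R -> R) :
  abs_continuous a b (x : R -> R^o) ->
  abs_continuous a b ((fun s => expR (x s)) : R -> R^o).
Proof.
move=> acx; have [K K0 HK] := abs_continuous_bounded acx.
apply: (abs_continuous_lipschitz acx (expR_gt0 K)) => u w au uw wb.
apply: expR_lipschitz; apply: (le_trans (ler_norm _)); apply: HK => //.
  exact: le_trans uw.
exact: le_trans wb.
Qed.

Lemma ler_mx_norm_coord (R : realType) (m n : nat) (A : 'M[R]_(m, n)) i j :
  `|A i j| <= `|A|.
Proof.
by rewrite [leRHS]/Num.Def.normr/= mx_normrE; exact: (le_bigmax _ _ (i, j)).
Qed.

Lemma mx_norm_le (R : realType) (m n : nat) (A : 'M[R]_(m, n)) (B : R) :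
  0 <= B -> (forall i j, `|A i j| <= B) -> `|A| <= B.
Proof.
move=> B0 AB; rewrite [leLHS]/Num.Def.normr/= mx_normrE.
by apply: bigmax_le => // -[i j] _; exact: AB.
Qed.

Lemma mx_norm_trmx (R : realType) (m n : nat) (A : 'M[R]_(m, n)) : `|A^T| = `|A|.
Proof.
apply/eqP; rewrite eq_le; apply/andP; split.
  by apply: mx_norm_le => // i j; rewrite mxE; exact: ler_mx_norm_coord.
apply: mx_norm_le => // i j; have := ler_mx_norm_coord A^T j i.
by rewrite mxE.
Qed.

Lemma abs_continuous_coord (R : realType) (a b : R) (m : nat) (x : R -> 'cV[R]_m) i :
  abs_continuous a b x -> abs_continuous a b ((fun s => x s i 0) : R -> R^o).
Proof.
move=> acx; apply: (abs_continuous_lipschitz acx ltr01) => u w _ _ _.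
have := ler_mx_norm_coord (x w - x u) i 0.
by rewrite mul1r !mxE.
Qed.

Lemma is_derive_coord (R : realType) (m : nat) (x : R -> 'cV[R]_m) (t : R) d i :
  is_derive t (1 : R) x d -> is_derive t (1 : R) (fun s => x s i 0) (d i 0).
Proof.
move=> [dx dxE]; have /derivable_mxP dxi := dx.
by apply: DeriveDef; [exact: dxi | rewrite -dxE derive_mx// mxE].
Qed.

(** * Convex costs and their generalized gradients *)

Definition dot (R : realType) (m : nat) (x y : 'cV[R]_m) : R :=
  \sum_i x i 0 * y i 0.

Lemma dotE (R : realType) (m : nat) (x y : 'cV[R]_m) :
  (x^T *m y) 0 0 = dot x y.
Proof. by rewrite mxE; apply: eq_bigr => i _; rewrite mxE. Qed.

Definition convex_real (R : realType) (phi : R -> R) := forall x y t,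
  0 <= t -> t <= 1 -> phi (t * x + (1 - t) * y) <= t * phi x + (1 - t) * phi y.

Lemma admissible_convex_real (R : realType) (f : R -> R) :
  admissible_cost f -> convex_real f.
Proof.
move=> [_ cf _ _] x y t t0 t1.
by have := cf (Itv01 t0 t1) x y; rewrite !inE => /(_ Logic.I Logic.I).
Qed.

Lemma convex_real_chord (R : realType) (phi : R -> R) (x y z : R) :
  convex_real phi -> x <= y -> y <= z ->
  (z - x) * phi y <= (z - y) * phi x + (y - x) * phi z.
Proof.
move=> cphi xy yz; have [xz|] := ltP x z; last first.
  move=> zx; have -> : y = x by lra.
  by have -> : z = x; lra.
have zx0 : 0 < z - x by rewrite subr_gt0.
have := cphi x z ((z - y) / (z - x)).
have -> : 1 - (z - y) / (z - x) = (y - x) / (z - x).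
  by field; rewrite gt_eqF.
have -> : (z - y) / (z - x) * x + (y - x) / (z - x) * z = y.
  by field; rewrite gt_eqF.
rewrite ler_pdivrMr// mul1r divr_ge0 ?subr_ge0 ?(ltW xz)//.
rewrite lerD2l lerN2 => /(_ isT xy).
rewrite -(ler_pM2l zx0) => /le_trans; apply.
by rewrite le_eqVlt; apply/orP; left; apply/eqP; field; rewrite gt_eqF.
Qed.

(** The slope over [[x, y]] is at most the slope over [[x, B + 1]], an interval of length at least 1
    over which the nonnegative [phi] rises by at most [phi (B + 1)]. *)
Lemma convex_real_le_slope (R : realType) (phi : R -> R) (B x y : R) :
  (forall u, 0 <= phi u) -> convex_real phi -> x <= y -> y <= B ->
  phi y - phi x <= phi (B + 1) * (y - x).
Proof.
move=> phi0 cphi xy yB; have [le|lt] := leP (phi y) (phi x).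
  apply: (@le_trans _ _ 0); first by rewrite subr_le0.
  by rewrite mulr_ge0// subr_ge0.
have yB1 : y <= B + 1 by lra.
have := convex_real_chord cphi xy yB1.
have : 0 <= phi x * (y - x) by rewrite mulr_ge0// subr_ge0.
have : phi y - phi x <= (B + 1 - x) * (phi y - phi x).
  by rewrite ler_peMl; lra.
lra.
Qed.

Lemma convex_real_ge_slope (R : realType) (phi : R -> R) (B x y : R) :
  (forall u, 0 <= phi u) -> convex_real phi -> x <= y -> - B <= x ->
  phi x - phi y <= phi (- B - 1) * (y - x).
Proof.
move=> phi0 cphi xy Bx.
have c' : convex_real (phi \o -%R).
  move=> u v t t0 t1 /=; have := cphi (- u) (- v) t t0 t1.
  by rewrite !mulrN -opprD.
have := @convex_real_le_slope R (phi \o -%R) B (- y) (- x).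
rewrite /= !opprK opprD [- x + y]addrC; apply => //; lra.
Qed.

Lemma convex_real_lipschitz (R : realType) (phi : R -> R) (B x y : R) :
  (forall u, 0 <= phi u) -> convex_real phi -> `|x| <= B -> `|y| <= B ->
  `|phi y - phi x| <= (phi (B + 1) + phi (- B - 1)) * `|y - x|.
Proof.
move=> phi0 cphi.
wlog xy : x y / x <= y.
  move=> H xB yB; have [xy|/ltW yx] := leP x y; first exact: H.
  by rewrite distrC (distrC y); exact: H.
rewrite !ler_norml => /andP[Bx xB] /andP[By yB].
rewrite [`|y - x|]ger0_norm ?subr_ge0//.
have h1 := convex_real_le_slope phi0 cphi xy yB.
have h2 := convex_real_ge_slope phi0 cphi xy Bx.
have h3 : 0 <= phi (B + 1) * (y - x) by rewrite mulr_ge0// subr_ge0.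
have h4 : 0 <= phi (- B - 1) * (y - x) by rewrite mulr_ge0// subr_ge0.
by apply/andP; split; lra.
Qed.

Lemma convex_real_continuous (R : realType) (phi : R -> R) :
  (forall u, 0 <= phi u) -> convex_real phi -> continuous phi.
Proof.
move=> phi0 cphi x; apply/cvgrPdist_lt => e e0.
set B := `|x| + 1; set K := phi (B + 1) + phi (- B - 1) + 1.
have K0 : 0 < K by rewrite ltr_wpDl// addr_ge0.
apply/nbhs_ballP; exists (Num.min 1 (e / K)).
  by rewrite /= lt_min ltr01 divr_gt0.
move=> y; rewrite /ball/= lt_min => /andP[xy1 xye].
have yB : `|y| <= B.
  have -> : y = x - (x - y) by ring.
  by apply: (le_trans (ler_normB _ _)); rewrite lerD2l ltW.
have xB : `|x| <= B by rewrite lerDl.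
apply: (le_lt_trans (convex_real_lipschitz phi0 cphi yB xB)).
move: xye; rewrite ltr_pdivlMr// mulrC; apply: le_lt_trans.
by rewrite ler_wpM2r// lerDl.
Qed.

(** The subgradient inequality is tested at [B + 1], at distance at least 1 from [x]. *)
Lemma subgradient_le (R : realType) (phi : R -> R) (s x B : R) :
  (forall u, 0 <= phi u) -> (forall y, s * (y - x) <= phi y - phi x) ->
  x <= B -> s <= phi (B + 1).
Proof.
move=> phi0 hs xB; have [s0|s0] := leP s 0; first exact: le_trans s0 _.
have := hs (B + 1); have := phi0 x.
have : s <= s * (B + 1 - x) by rewrite ler_peMr; lra.
lra.
Qed.

Lemma subgradient_ge (R : realType) (phi : R -> R) (s x B : R) :
  (forall u, 0 <= phi u) -> (forall y, s * (y - x) <= phi y - phi x) ->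
  - B <= x -> - phi (- B - 1) <= s.
Proof.
move=> phi0 hs xB; have [s0|s0] := leP 0 s.
  by apply: le_trans s0; rewrite oppr_le0.
have := hs (- B - 1); have := phi0 x.
have : - s <= - s * (x - (- B - 1)) by rewrite ler_peMr; lra.
lra.
Qed.

Lemma convex_real_tangent (R : realType) (f : R -> R) (x y : R) :
  convex_real f -> derivable f x 1 -> 'D_1 f x * (y - x) <= f y - f x.
Proof.
move=> cf df; set d := 'D_1 f x; set v := y - x.
have [v0|v0] := eqVneq v 0.
  by rewrite v0 mulr0 (_ : y = x) ?subrr//; apply/eqP; rewrite -subr_eq0 -/v v0.
apply/ler_addgt0Pr => e e0.
have nv0 : 0 < `|v| by rewrite normr_gt0.
have /cvgrPdist_lt /(_ (e / `|v|)) : h^-1 *: ((f \o shift x) (h *: (1 : R)) - f x)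
    @[h --> 0^'] --> d by exact: df.
rewrite divr_gt0// => /(_ isT) /nbhs_ballP[r /= r0 Hr].
(* The bound 1 lets convexity apply between [x] and [y]; the other bound keeps [t * v] within the
   radius [r] where the difference quotient is close to [d]. *)
set t := Num.min 1 (r / (2 * `|v|)).
have t0 : 0 < t by rewrite lt_min ltr01 divr_gt0// mulr_gt0.
have t1 : t <= 1 by rewrite ge_min lexx.
have := Hr (t * v).
have tv : `|t * v| = t * `|v| by rewrite normrM gtr0_norm.
rewrite /ball/= sub0r normrN tv.
have -> : t * `|v| < r.
  apply: (@le_lt_trans _ _ (r / 2)); last by lra.
  have -> : r / 2 = r / (2 * `|v|) * `|v| by field; rewrite gt_eqF.
  by rewrite ler_wpM2r// ge_min lexx orbT.
have tv0 : t * v != 0 by rewrite mulf_neq0// gt_eqF.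
move=> /(_ isT tv0); rewrite /shift/= -[_ *: 1]/(_ * 1) mulr1.
rewrite -[_ *: _]/(_ * _) => Hq.
have Hq2 : `|d * (t * v) - (f (t * v + x) - f x)| <= e / `|v| * (t * `|v|).
  have -> : d * (t * v) - (f (t * v + x) - f x) =
      (d - (t * v)^-1 * (f (t * v + x) - f x)) * (t * v).
    by rewrite mulrBl mulrAC mulVf// mul1r.
  by rewrite normrM tv ler_wpM2r ?mulr_ge0 ?(ltW t0)// ltW.
have Hc := cf y x t (ltW t0) t1.
have E : t * y + (1 - t) * x = t * v + x by rewrite /v; ring.
rewrite E in Hc.
have {}Hq2 := le_trans (ler_norm _) Hq2.
have E2 : e / `|v| * (t * `|v|) = t * e by field; rewrite gt_eqF.
rewrite E2 in Hq2.
rewrite -(ler_pM2l t0); lra.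
Qed.

(* For convex F the difference quotient is nondecreasing in h, so the limsup
   defining Clarke's directional derivative is at most the increment at h = 1. *)
Lemma clarke_gradient_subgradient (R : realType) (m : nat) (F : 'cV[R]_m -> R)
    (x g v : 'cV[R]_m) :
  (forall x y t, 0 <= t -> t <= 1 ->
     F (t *: x + (1 - t) *: y) <= t * F x + (1 - t) * F y) ->
  continuous F -> clarke_gradient F x g -> dot g v <= F (x + v) - F x.
Proof.
move=> cF contF /(_ v); rewrite dotE => Hg.
apply/ler_addgt0Pr => e e0; rewrite -lee_fin; apply: (le_trans Hg).
rewrite /clarke_dir limf_esupE.
have e2 : 0 < e / 2 by rewrite divr_gt0.
have /cvgrPdist_lt /(_ _ e2) /nbhs_ballP[r1 /= r10 H1] := contF x.
have /cvgrPdist_lt /(_ _ e2) /nbhs_ballP[r2 /= r20 H2] := contF (x + v).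
(* The limsup is at most the supremum over a single member of the filter, here [A] times the open
   unit interval. There convexity bounds each quotient by [F (y + v) - F y], which [A] keeps within
   [e] of the increment at [x]. *)
pose A := [set y : 'cV[R]_m | `|F (x + v) - F x - (F (y + v) - F y)| < e].
pose H := [set h : R | 0 < h /\ h < 1].
apply: (@le_trans _ _ (ereal_sup ((fun p : 'cV[R]_m * R =>
    ((F (p.1 + p.2 *: v) - F p.1) / p.2)%:E) @` (A `*` H)))).
  apply: ereal_inf_lbound; exists (A `*` H) => //.
  exists (A, H) => //; split => //=.
    apply/nbhs_ballP; exists (Num.min r1 r2); first by rewrite /= lt_min r10.
    move=> y; rewrite -ball_normE/= lt_min => /andP[y1 y2]; rewrite /A/=.
    have := H1 y; rewrite -ball_normE => /(_ y1) h1.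
    have := H2 (y + v); rewrite -ball_normE/= opprD addrACA subrr addr0 => /(_ y2) h2.
    rewrite (_ : _ - _ = (F (x + v) - F (y + v)) - (F x - F y)); last by ring.
    by apply: (le_lt_trans (ler_normB _ _)); rewrite (splitr e) ltrD.
  by near=> h; split; near: h; [exact: nbhs_right_gt | exact: nbhs_right_lt].
apply: ub_ereal_sup => _ [[y h] [/= Ay [h0 h1]] <-]; rewrite lee_fin.
rewrite ler_pdivrMr//.
have := cF (y + v) y h (ltW h0) (ltW h1).
have -> : h *: (y + v) + (1 - h) *: y = y + h *: v.
  by rewrite scalerDr scalerBl scale1r addrACA subrr addr0 addrC [h *: v + _]addrC
     || by rewrite scalerDr scalerBl scale1r addrC addrA subrK.
move: Ay; rewrite /A/= => /ltr_normlP[+ _]; rewrite opprB => Ay.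
have : h * (F (y + v) - F y) <= h * (F (x + v) - F x + e).
  by rewrite ler_pM2l//; lra.
lra.
Unshelve. all: by end_near. Qed.

(** * Extreme eigenvalues of symmetric matrices *)

Lemma continuous_sum (R : realType) (T : topologicalType) (m : nat)
    (phi : 'I_m -> T -> R) :
  (forall i, continuous (phi i)) -> continuous (fun x => \sum_i phi i x).
Proof.
elim: m phi => [|m IH] phi cphi x.
  rewrite (_ : (fun _ => _) = fun=> 0); first exact: cvg_cst.
  by apply/funext => y; rewrite big_ord0.
rewrite (_ : (fun _ => _) =
    phi ord0 + (fun y => \sum_i phi (lift ord0 i) y)); last first.
  by apply/funext => y; rewrite big_ord_recl.
by apply: continuousD; [exact: cphi | apply: IH].
Qed.

Lemma continuous_mul (R : realType) (T : topologicalType) (f g : T -> R) :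
  continuous f -> continuous g -> continuous (fun x => f x * g x).
Proof. by move=> cf cg x; apply: continuousM; [exact: cf | exact: cg]. Qed.

Lemma dotC (R : realType) (m : nat) (x y : 'cV[R]_m) : dot x y = dot y x.
Proof. by apply: eq_bigr => i _; rewrite mulrC. Qed.

Lemma dotDl (R : realType) (m : nat) (x y z : 'cV[R]_m) :
  dot (x + y) z = dot x z + dot y z.
Proof. by rewrite -big_split; apply: eq_bigr => i _; rewrite mxE mulrDl. Qed.

Lemma dotDr (R : realType) (m : nat) (x y z : 'cV[R]_m) :
  dot z (x + y) = dot z x + dot z y.
Proof. by rewrite !(dotC z) dotDl. Qed.

Lemma dotZl (R : realType) (m : nat) (a : R) (x y : 'cV[R]_m) :
  dot (a *: x) y = a * dot x y.
Proof. by rewrite mulr_sumr; apply: eq_bigr => i _; rewrite mxE mulrA. Qed.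

Lemma dotZr (R : realType) (m : nat) (a : R) (x y : 'cV[R]_m) :
  dot x (a *: y) = a * dot x y.
Proof. by rewrite dotC dotZl dotC. Qed.

Lemma dotNl (R : realType) (m : nat) (x y : 'cV[R]_m) : dot (- x) y = - dot x y.
Proof. by rewrite -scaleN1r dotZl mulN1r. Qed.

Lemma dotNr (R : realType) (m : nat) (x y : 'cV[R]_m) : dot x (- y) = - dot x y.
Proof. by rewrite dotC dotNl dotC. Qed.

Lemma dot_trmx (R : realType) (m : nat) (A : 'M[R]_m) (x y : 'cV[R]_m) :
  dot (A *m x) y = dot x (A^T *m y).
Proof. by rewrite -!dotE trmx_mul mulmxA. Qed.

Lemma dot_ge0 (R : realType) (m : nat) (x : 'cV[R]_m) : 0 <= dot x x.
Proof. by apply: sumr_ge0 => i _; rewrite -expr2 sqr_ge0. Qed.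

Lemma dot_eq0 (R : realType) (m : nat) (x : 'cV[R]_m) : (dot x x == 0) = (x == 0).
Proof.
apply/idP/eqP => [/eqP x0|->]; last first.
  by rewrite /dot big1// => i _; rewrite mxE mul0r.
apply/colP => i; rewrite mxE; apply/eqP; rewrite -sqrf_eq0 expr2; apply/eqP.
have H : forall i, i \in 'I_m -> 0 <= x i 0 * x i 0.
  by move=> j _; rewrite -expr2 sqr_ge0.
by have := @psumr_eq0P _ _ predT (fun i => x i 0 * x i 0)
  (fun j _ => H j isT) x0; apply.
Qed.

Lemma eigenvalueP_col (R : realType) (m : nat) (A : 'M[R]_m) (l : R) :
  A^T = A -> eigenvalue A l <-> exists2 x : 'cV[R]_m, A *m x = l *: x & x != 0.
Proof.
move=> sA; split.
  move=> /eigenvalueP[v vA v0]; exists v^T; last by rewrite trmx_eq0.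
  by rewrite -{1}sA -trmx_mul vA linearZ.
move=> [x xA x0]; apply/eigenvalueP; exists x^T; last by rewrite trmx_eq0.
by rewrite -{1}sA -trmx_mul xA linearZ.
Qed.

Lemma max_on_sphere (R : realType) (m : nat) (A : 'M[R]_m) : (0 < m)%N ->
  exists2 c : 'cV[R]_m, dot c c = 1 &
    forall x, dot x x = 1 -> dot x (A *m x) <= dot c (A *m c).
Proof.
move=> m0.
(* The form is transported to row vectors, for which the extreme value theorem used below is
   stated. *)
pose q (x : 'rV[R]_m) := dot x^T (A *m x^T).
pose n2 (x : 'rV[R]_m) := dot x^T x^T.
have cc i : continuous (fun x : 'rV[R]_m => x 0 i) by exact: coord_continuous.
have cq : continuous q.
  rewrite (_ : q = fun x => \sum_i \sum_j (A i j * (x 0 i * x 0 j))); last first.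
    apply/funext => x; apply: eq_bigr => i _.
    by rewrite !mxE mulr_sumr; apply: eq_bigr => j _; rewrite !mxE; ring.
  apply: continuous_sum => i; apply: continuous_sum => j.
  by apply: continuous_mul; [exact: cst_continuous | exact: continuous_mul].
have cn : continuous n2.
  rewrite (_ : n2 = fun x => \sum_i x 0 i * x 0 i); last first.
    by apply/funext => x; apply: eq_bigr => i _; rewrite !mxE.
  by apply: continuous_sum => i; exact: continuous_mul.
pose S := [set x | n2 x = 1].
have S0 : S !=set0.
  exists (delta_mx 0 (Ordinal m0)); rewrite /S/= /n2 /dot (bigD1 (Ordinal m0))//=.
  rewrite !mxE !eqxx mulr1 big1 ?addr0// => i ni.
  by rewrite !mxE (negbTE ni) andbF mul0r.
have cS : compact S.
  apply: bounded_closed_compact.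
    exists 1; split => // y y1 x Sx; apply: (le_trans _ (ltW y1)).
    apply: mx_norm_le => // i j.
    rewrite -(@ler_pXn2r _ 2)// ?nnegrE// expr1n -Sx /n2 /dot (bigD1 j)//=.
    rewrite (ord1 i) real_normK ?num_real// !mxE -expr2 lerDl.
    by apply: sumr_ge0 => k _; rewrite -expr2 sqr_ge0.
  apply: (@preimage_closed 'rV[R]_m R n2 [set y | y = 1]); first by move=> x _; exact: cn.
  exact: closed_eq.
have [c cS1 Hc] := EVT_max_rV S0 cS (continuous_subspaceT cq).
exists c^T; first by have := set_mem cS1.
by move=> x x1; have := Hc x^T; rewrite /q trmxK; apply; rewrite inE /S/= /n2 trmxK.
Qed.

(* First-order optimality at a maximiser of the quadratic form on the unit sphere
   makes it an eigenvector. *)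
Lemma symmetric_max_eigenvalue (R : realType) (m : nat) (A : 'M[R]_m) :
  A^T = A -> (0 < m)%N ->
  exists2 mu, eigenvalue A mu & forall x, dot x (A *m x) <= mu * dot x x.
Proof.
move=> sA m0; have [c c1 Hc] := max_on_sphere A m0.
set mu := dot c (A *m c) in Hc.
have Hmu x : dot x (A *m x) <= mu * dot x x.
  have [->|x0] := eqVneq x 0.
    by rewrite mulmx0 /dot !big1 ?mulr0// => i _; rewrite mxE mul0r.
  have d0 : 0 < dot x x by rewrite lt_neqAle dot_ge0 andbT eq_sym dot_eq0.
  have s0 : 0 < Num.sqrt (dot x x) by rewrite sqrtr_gt0.
  have ss : (Num.sqrt (dot x x))^-1 * (Num.sqrt (dot x x))^-1 = (dot x x)^-1.
    by rewrite -invfM -expr2 sqr_sqrtr// ltW.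
  have := Hc ((Num.sqrt (dot x x))^-1 *: x).
  rewrite -scalemxAr !dotZl !dotZr !mulrA ss mulVf ?gt_eqF// => /(_ erefl).
  by rewrite mulrC ler_pdivrMr.
exists mu => //.
apply/(eigenvalueP_col _ sA); exists c; last first.
  by rewrite -dot_eq0 c1 oner_eq0.
set w := A *m c - mu *: c.
apply/eqP; rewrite -subr_eq0 -/w -dot_eq0; apply: contraT => w0.
have {}w0 : 0 < dot w w by rewrite lt_neqAle dot_ge0 andbT eq_sym.
set K := mu * dot w w - dot w (A *m w).
have K0 : 0 <= K by rewrite subr_ge0.
have Hw : dot w (A *m c) = dot w w + mu * dot w c.
  by rewrite -[in RHS]dotZr -dotDr subrK.
have cAw : dot c (A *m w) = dot w (A *m c) by rewrite dotC dot_trmx sA.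
(* Perturbing [c] to [c + t w] gives [2 t |w|^2 <= t^2 K]. With this [t], [t K < |w|^2], a
   contradiction. *)
pose t := dot w w / (K + 1).
have t0 : 0 < t by rewrite divr_gt0// ltr_wpDl.
have := Hmu (c + t *: w).
rewrite mulmxDr -scalemxAr !dotDl !dotDr !dotZl !dotZr cAw Hw c1 -/mu (dotC c w).
have tK : t * K < dot w w.
  rewrite /t mulrAC ltr_pdivrMr ?ltr_wpDl// ltr_pM2l//; lra.
move=> H.
have : t * (2 * dot w w) <= t * (t * K) by rewrite /K; lra.
by rewrite ler_pM2l//; lra.
Qed.

Lemma symmetric_min_eigenvalue (R : realType) (m : nat) (A : 'M[R]_m) :
  A^T = A -> (0 < m)%N ->
  exists2 mu, eigenvalue A mu & forall x, mu * dot x x <= dot x (A *m x).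
Proof.
move=> sA m0.
have sN : (- A)^T = - A by rewrite linearN /= sA.
have [mu mue Hmu] := symmetric_max_eigenvalue sN m0.
exists (- mu).
  have /(eigenvalueP_col _ sN)[x xA x0] := mue.
  by apply/(eigenvalueP_col _ sA); exists x => //; rewrite scaleNr -xA mulNmx opprK.
by move=> x; have := Hmu x; rewrite mulNmx dotNr mulNr; lra.
Qed.

Lemma eigenvalue_rayleigh (R : realType) (m : nat) (A : 'M[R]_m) (l : R) :
  A^T = A -> eigenvalue A l ->
  exists2 x : 'cV[R]_m, dot x (A *m x) = l * dot x x & 0 < dot x x.
Proof.
move=> sA /(eigenvalueP_col _ sA)[x xA x0]; exists x; first by rewrite xA dotZr.
by rewrite lt_neqAle dot_ge0 andbT eq_sym dot_eq0.
Qed.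

(** The maximum of the Rayleigh quotient is itself an eigenvalue and bounds all the others, so the
    supremum in [lambda_max] is attained there. *)
Lemma lambda_maxP (R : realType) (m : nat) (A : 'M[R]_m) :
  A^T = A -> (0 < m)%N -> eigenvalue A (lambda_max A) /\
  forall x, dot x (A *m x) <= lambda_max A * dot x x.
Proof.
move=> sA m0; have [mu mue Hmu] := symmetric_max_eigenvalue sA m0.
have ubm : ubound [set l | eigenvalue A l] mu.
  move=> l /(eigenvalue_rayleigh sA)[x xA x0]; have := Hmu x.
  by rewrite xA ler_pM2r.
suff -> : lambda_max A = mu by [].
apply/eqP; rewrite eq_le; apply/andP; split.
  by apply: ge_sup => //; exists mu.
by apply: ub_le_sup => //; exists mu.
Qed.

Lemma lambda_minP (R : realType) (m : nat) (A : 'M[R]_m) :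
  A^T = A -> (0 < m)%N -> eigenvalue A (lambda_min A) /\
  forall x, lambda_min A * dot x x <= dot x (A *m x).
Proof.
move=> sA m0; have [mu mue Hmu] := symmetric_min_eigenvalue sA m0.
have lbm : lbound [set l | eigenvalue A l] mu.
  move=> l /(eigenvalue_rayleigh sA)[x xA x0]; have := Hmu x.
  by rewrite xA ler_pM2r.
suff -> : lambda_min A = mu by [].
apply/eqP; rewrite eq_le; apply/andP; split.
  by apply: ge_inf => //; exists mu.
by apply: lb_le_inf => //; exists mu.
Qed.

Lemma lambda_two_ge0 (R : realType) (m : nat) (Q : 'M[R]_m) :
  Q^T = Q -> (forall x, 0 <= dot x (Q *m x)) -> 0 <= lambda_two Q.
Proof.
move=> sQ psdQ; have [[l El]|nE] := pselect ([set l | eigenvalue Q l /\ l != 0] !=set0).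
  apply: lb_le_inf; first by exists l.
  move=> l' [/(eigenvalue_rayleigh sQ)[x xQ x0] _]; have := psdQ x.
  by rewrite xQ pmulr_lge0.
rewrite /lambda_two (_ : [set l | _] = set0) ?inf0//.
by apply/seteqP; split => // l El; apply: nE; exists l.
Qed.

Lemma dot_ones (R : realType) (m : nat) (x : 'cV[R]_m) :
  dot (ones R m) x = \sum_i x i 0.
Proof. by apply: eq_bigr => i _; rewrite mxE mul1r. Qed.

(* Adding lambda_two / m times the all-ones matrix J to Q moves its eigenvalue 0
   to lambda_two and keeps the others, so that Q + (lambda_two / m) J has all its
   eigenvalues >= lambda_two. *)
Lemma lambda_twoP (R : realType) (m : nat) (Q : 'M[R]_m) :
  Q^T = Q -> (0 < m)%N -> Q *m ones R m = 0 ->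
  (forall x, 0 <= dot x (Q *m x)) ->
  (forall x, dot x (Q *m x) = 0 -> exists a, x = a *: ones R m) ->
  forall x, lambda_two Q * (dot x x - (\sum_i x i 0) ^+ 2 / m%:R) <= dot x (Q *m x).
Proof.
move=> sQ m0 Q1 psdQ kerQ x; set l2 := lambda_two Q.
have mR : (m%:R : R) != 0 by rewrite pnatr_eq0 -lt0n.
pose J : 'M[R]_m := const_mx 1.
pose A := Q + (l2 / m%:R) *: J.
have sA : A^T = A by rewrite /A linearD linearZ /= sQ trmx_const.
have Jx y : J *m y = (\sum_i y i 0) *: ones R m.
  apply/colP => i; rewrite !mxE mulr1; apply: eq_bigr => j _.
  by rewrite mxE mul1r.
have [mu mue Hmu] := symmetric_min_eigenvalue sA m0.
suff l2mu : l2 <= mu.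
  have : l2 * dot x x <= dot x (A *m x).
    by apply: le_trans (Hmu x); rewrite ler_wpM2r// dot_ge0.
  rewrite /A mulmxDl dotDr -scalemxAl dotZr Jx dotZr (dotC x (ones R m)) dot_ones.
  have -> : l2 / m%:R * ((\sum_i x i 0) * (\sum_i x i 0)) =
    l2 * ((\sum_i x i 0) ^+ 2 / m%:R) by field.
  lra.
have /(eigenvalueP_col _ sA)[y yA y0] := mue.
(* Pairing the eigenvector [y] with the all-ones vector gives [mu = l2] unless the coordinates of
   [y] sum to 0. In that case [y] is an eigenvector of [Q], and its eigenvalue is nonzero because
   the kernel of [Q] consists of multiples of the all-ones vector. *)
have sQy : dot (ones R m) (Q *m y) = 0.
  by rewrite dotC dot_trmx sQ Q1 /dot big1// => i _; rewrite mxE mulr0.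
have d11 : dot (ones R m) (ones R m) = m%:R.
  rewrite dot_ones (eq_bigr (fun=> 1)) => [|i _]; last by rewrite mxE.
  by rewrite sumr_const card_ord.
have : dot (ones R m) (A *m y) = mu * \sum_i y i 0.
  by rewrite yA dotZr dot_ones.
rewrite mulmxDl dotDr sQy add0r -scalemxAl dotZr Jx dotZr d11.
rewrite [LHS](_ : _ = l2 * \sum_i y i 0); last by field.
move=> Hs.
have [s0|s0] := eqVneq (\sum_i y i 0) 0; last first.
  by have /(mulIf s0) -> := Hs.
have yQ : Q *m y = mu *: y.
  by move: yA; rewrite mulmxDl -scalemxAl Jx s0 scale0r scaler0 addr0.
have [mu0|mu0] := eqVneq mu 0.
  have [|a ya] := kerQ y.
    by rewrite yQ mu0 scale0r /dot big1// => i _; rewrite mxE mulr0.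
  exfalso; move/eqP: y0; apply; rewrite ya.
  move: s0; rewrite ya -dot_ones dotZr d11 => /eqP.
  by rewrite mulf_eq0 (negbTE mR) orbF => /eqP ->; rewrite scale0r.
apply: ge_inf; last by split => //; apply/(eigenvalueP_col _ sQ); exists y.
exists 0 => l [/(eigenvalue_rayleigh sQ)[u uQ u0] _]; have := psdQ u.
by rewrite uQ pmulr_lge0.
Qed.

(** * Laplacians *)

Definition mean (R : realType) (m : nat) (x : 'cV[R]_m) : R :=
  (\sum_i x i 0) / m%:R.

Definition dev (R : realType) (m : nat) (x : 'cV[R]_m) : 'cV[R]_m :=
  x - mean x *: ones R m.

Lemma dot_dev (R : realType) (m : nat) (x y : 'cV[R]_m) :
  dot (dev x) (dev y) = dot x y - (\sum_i x i 0) * (\sum_i y i 0) / m%:R.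
Proof.
(* For [m = 0] the convention [0^-1 = 0] makes both corrections vanish. *)
rewrite /dev /mean; have [m0|m0] := eqVneq (m%:R : R) 0.
  rewrite m0 invr0 !mulr0 !scale0r !subr0 //.
rewrite !dotDl !dotDr !dotNl !dotNr !dotZl !dotZr (dotC x (ones R m)).
rewrite !dot_ones (_ : \sum_i ones R m i 0 = m%:R); last first.
  rewrite (eq_bigr (fun=> 1)) => [|i _]; last by rewrite mxE.
  by rewrite sumr_const card_ord.
by field.
Qed.

Section laplacian_theory.
Variables (R : realType) (n : nat) (G : wdigraph R n).
Hypothesis balG : weight_balanced G.
Let m := #|vertices G|.
Let L := laplacian G.

Lemma laplacian_mul (x : 'cV[R]_m) i :
  (L *m x) i 0 = \sum_j adj_vert G i j * (x i 0 - x j 0).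
Proof.
rewrite /L /laplacian mulmxBl mul_diag_mx !mxE mulr_suml -sumrB.
by apply: eq_bigr => j _; rewrite mulrBr.
Qed.

Lemma laplacian_ones : L *m ones R m = 0.
Proof.
apply/colP => i; rewrite laplacian_mul [RHS]mxE big1// => j _.
by rewrite !mxE subrr mulr0.
Qed.

Lemma adj_vert_ge0 i j : 0 <= adj_vert G i j.
Proof. by rewrite mxE; exact: adj_ge0. Qed.

Lemma adj_vert_balanced i : \sum_j adj_vert G i j = \sum_j adj_vert G j i.
Proof.
have := balG (enum_valP i).
rewrite (big_enum_val (fun j => adj G (enum_val i) j)).
rewrite (big_enum_val (fun j => adj G j (enum_val i))) => H.
rewrite (eq_bigr (fun j => adj G (enum_val i) (enum_val j))); last by move=> j _; rewrite mxE.
by rewrite H; apply: eq_bigr => j _; rewrite mxE.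
Qed.

(** Twice [a_ij x_i (x_i - x_j)] is [a_ij (x_i - x_j)^2] plus [a_ij x_i^2 - a_ij x_j^2]; weight
    balance makes the last two terms cancel in the double sum. *)
Lemma laplacian_quadratic (x : 'cV[R]_m) :
  2 * dot x (L *m x) = \sum_i \sum_j adj_vert G i j * (x i 0 - x j 0) ^+ 2.
Proof.
rewrite mulr_sumr.
rewrite (eq_bigr (fun i => \sum_j adj_vert G i j * (x i 0 - x j 0) ^+ 2 +
    (\sum_j adj_vert G i j * x i 0 ^+ 2 - \sum_j adj_vert G i j * x j 0 ^+ 2))).
  rewrite big_split/= sumrB [X in _ + (_ - X)]exchange_big/= -sumrB.
  rewrite [X in _ + X]big1 ?addr0// => i _.
  by rewrite -!mulr_suml adj_vert_balanced subrr.
move=> i _; rewrite laplacian_mul !mulr_sumr -sumrB -big_split/=.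
by apply: eq_bigr => j _; ring.
Qed.

Lemma laplacian_trmx_ones : L^T *m ones R m = 0.
Proof.
apply/colP => i; rewrite mxE [RHS]mxE.
rewrite (eq_bigr (fun j => (\row_i \sum_j adj_vert G i j) 0 j *+ (j == i) -
    adj_vert G j i)); last first.
  by move=> j _; rewrite !mxE mulr1.
rewrite sumrB (bigD1 i)//= eqxx mulr1n big1 => [|j /negbTE ->]; last by rewrite mulr0n.
by rewrite addr0 mxE adj_vert_balanced subrr.
Qed.

Lemma sum_laplacian_mul (x : 'cV[R]_m) : \sum_i (L *m x) i 0 = 0.
Proof.
rewrite -dot_ones dotC dot_trmx laplacian_trmx_ones /dot big1// => i _.
by rewrite mxE mulr0.
Qed.

(** A vanishing sum of nonnegative terms forces [x] to agree at the two ends of every edge, hence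
    along every path. *)
Lemma laplacian_kernel (x : 'cV[R]_m) :
  strongly_connected G -> dot x (L *m x) = 0 -> exists a, x = a *: ones R m.
Proof.
move=> conG x0.
have edge_eq i j : edge G (enum_val i) (enum_val j) -> x i 0 = x j 0.
  move=> eij; apply/eqP; rewrite -subr_eq0 -sqrf_eq0; apply/eqP.
  have sum0 := laplacian_quadratic x; rewrite x0 mulr0 in sum0.
  have h0 i' j' : 0 <= adj_vert G i' j' * (x i' 0 - x j' 0) ^+ 2.
    by rewrite mulr_ge0// ?sqr_ge0// adj_vert_ge0.
  have := psumr_eq0P (fun i' _ => sumr_ge0 _ (fun j' _ => h0 i' j')) (esym sum0).
  move=> /(_ i isT) sumi.
  have := psumr_eq0P (fun j' _ => h0 i j') sumi.
  move=> /(_ j isT) /eqP; rewrite mulf_eq0 => /orP[|/eqP//].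
  by rewrite mxE => /eqP aij0; move: eij; rewrite /edge aij0 ltxx.
have path_eq p : forall i j, path (edge G) (enum_val i) p ->
    last (enum_val i) p = enum_val j -> x i 0 = x j 0.
  elim: p => [|k p IH] i j /=; first by move=> _ /enum_val_inj ->.
  move=> /andP[eik pp] lj.
  (* A path in ['I_n] never leaves the vertex set, so each of its points has a coordinate of [x]. *)
  have kV : k \in vertices G by have /andP[] := adj_vertices eik.
  have kE := enum_rankK_in kV kV.
  rewrite -kE in eik pp lj.
  by rewrite (edge_eq _ _ eik); exact: IH lj.
have xij i j : x i 0 = x j 0.
  have /connectP[p pp lp] := conG _ _ (enum_valP i) (enum_valP j).
  exact: path_eq pp (esym lp).
have [m0|m0] := posnP m.
  by exists 0; apply/colP => i; have := leq_trans (ltn_ord i) (eq_leq m0).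
exists (x (Ordinal m0) 0); apply/colP => i; rewrite !mxE mulr1; exact: xij.
Qed.

Lemma sym_laplacian : (L + L^T)^T = L + L^T.
Proof. by rewrite linearD /= trmxK addrC. Qed.

Lemma dot_sym_laplacian (x : 'cV[R]_m) : dot x ((L + L^T) *m x) = 2 * dot x (L *m x).
Proof. by rewrite mulmxDl dotDr -dot_trmx (dotC (L *m x)); ring. Qed.

Lemma laplacian_psd (x : 'cV[R]_m) : 0 <= dot x ((L + L^T) *m x).
Proof.
rewrite dot_sym_laplacian laplacian_quadratic; apply: sumr_ge0 => i _.
by apply: sumr_ge0 => j _; rewrite mulr_ge0 ?sqr_ge0// adj_vert_ge0.
Qed.

Lemma lambda_two_laplacian_ge0 : 0 <= lambda_two (L + L^T).
Proof. exact: lambda_two_ge0 sym_laplacian laplacian_psd. Qed.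

Lemma dot_dev_laplacian (x : 'cV[R]_m) : (0 < m)%N -> strongly_connected G ->
  lambda_two (L + L^T) / 2 * dot (dev x) (dev x) <= dot x (L *m x).
Proof.
move=> m0 conG.
have Q1 : (L + L^T) *m ones R m = 0.
  by rewrite mulmxDl laplacian_ones laplacian_trmx_ones addr0.
have ker y : dot y ((L + L^T) *m y) = 0 -> exists a, y = a *: ones R m.
  by rewrite dot_sym_laplacian => /eqP; rewrite mulf_eq0 pnatr_eq0/= => /eqP;
    exact: laplacian_kernel.
have := lambda_twoP sym_laplacian m0 Q1 laplacian_psd ker x.
by rewrite dot_sym_laplacian dot_dev -expr2; lra.
Qed.

Lemma laplacian_dev (x : 'cV[R]_m) : L *m dev x = L *m x.
Proof.
by rewrite mulmxDr mulmxN -scalemxAr laplacian_ones scaler0 subr0.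
Qed.

Lemma sym_laplacian_gram : (L^T *m L)^T = L^T *m L.
Proof. by rewrite trmx_mul trmxK. Qed.

Lemma dot_laplacian_gram (x : 'cV[R]_m) : dot x ((L^T *m L) *m x) = dot (L *m x) (L *m x).
Proof. by rewrite -mulmxA -dot_trmx. Qed.

Lemma lambda_max_gram_ge0 : (0 < m)%N -> 0 <= lambda_max (L^T *m L).
Proof.
move=> m0; have [+ _] := lambda_maxP sym_laplacian_gram m0.
move=> /(eigenvalue_rayleigh sym_laplacian_gram)[x xL x0].
have := dot_ge0 (L *m x).
by rewrite -dot_laplacian_gram xL pmulr_lge0.
Qed.

Lemma norm_laplacian_dev (x : 'cV[R]_m) : (0 < m)%N ->
  dot (L *m x) (L *m x) <= lambda_max (L^T *m L) * dot (dev x) (dev x).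
Proof.
move=> m0; have [_ H] := lambda_maxP sym_laplacian_gram m0.
by rewrite -laplacian_dev -dot_laplacian_gram.
Qed.

End laplacian_theory.

(** * Mismatch between generation and load *)

Lemma ae_imp (R : realType) (P Q : R -> Prop) : (forall t, P t -> Q t) ->
  {ae (@lebesgue_measure R), forall t, P t} ->
  {ae (@lebesgue_measure R), forall t, Q t}.
Proof. by move=> PQ; apply: negligibleS => t /= nQ /PQ; exact: nQ. Qed.

Section real_derivatives.
Variables (R : realType) (t : R).
Implicit Types f g : R -> R.

Lemma is_derive_mul f g df dg :
  is_derive t (1 : R) f df -> is_derive t (1 : R) g dg ->
  is_derive t (1 : R) (fun s => f s * g s) (df * g t + f t * dg).
Proof.
move=> hf hg; have := is_deriveM hf hg.
by rewrite -![_ *: _]/(_ * _) addrC [g t * df]mulrC.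
Qed.

Lemma is_derive_add f g df dg :
  is_derive t (1 : R) f df -> is_derive t (1 : R) g dg ->
  is_derive t (1 : R) (fun s => f s + g s) (df + dg).
Proof. exact: is_deriveD. Qed.

Lemma is_derive_sub f g df dg :
  is_derive t (1 : R) f df -> is_derive t (1 : R) g dg ->
  is_derive t (1 : R) (fun s => f s - g s) (df - dg).
Proof. exact: is_deriveB. Qed.

Lemma is_derive_const (c : R) : is_derive t (1 : R) (fun _ : R => c) 0.
Proof. exact: is_derive_cst. Qed.

Lemma is_derive_scale c f df : is_derive t (1 : R) f df ->
  is_derive t (1 : R) (fun s => c * f s) (c * df).
Proof.
move=> hf; have := is_derive_mul (is_derive_const c) hf.
by rewrite mul0r add0r.
Qed.

Lemma is_derive_exp f df : is_derive t (1 : R) f df ->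
  is_derive t (1 : R) (fun s => expR (f s)) (expR (f t) * df).
Proof. by move=> hf; apply: (@is_derive1_comp R expR f). Qed.

Lemma is_derive_bigsum (m : nat) (f : 'I_m -> R -> R) df :
  (forall i, is_derive t (1 : R) (f i) (df i)) ->
  is_derive t (1 : R) (fun s => \sum_i f i s) (\sum_i df i).
Proof.
move=> hf; have := is_derive_sum hf.
by rewrite (_ : \sum_(i < m) f i = fun s => \sum_i f i s)//; apply/funext => s;
  rewrite fct_sumE.
Qed.

End real_derivatives.

Lemma abs_continuous_derive_le0 (R : realType) (h : R -> R) (a b : R) :
  a <= b -> abs_continuous a b (h : R -> R^o) ->
  {ae (@lebesgue_measure R), forall t, a < t < b ->
    exists2 d, is_derive t (1 : R) h d & d <= 0} ->
  h b <= h a.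
Proof.
move=> ab ach aeh; apply: abs_continuous_nonincreasing ab ach _.
by apply: (ae_imp _ aeh) => t Ht /Ht[d hd d0]; exists h, d; split.
Qed.

Lemma abs_continuous_derive_eq0 (R : realType) (h : R -> R) (a b : R) :
  a <= b -> abs_continuous a b (h : R -> R^o) ->
  {ae (@lebesgue_measure R), forall t, a < t < b -> is_derive t (1 : R) h 0} ->
  h b = h a.
Proof.
move=> ab ach aeh; apply/eqP; rewrite eq_le; apply/andP; split.
  apply: abs_continuous_derive_le0 ab ach _.
  by apply: (ae_imp _ aeh) => t Ht /Ht hd; exists 0.
rewrite -lerN2.
apply: (@abs_continuous_derive_le0 R (fun s => - h s) a b ab).
  have := abs_continuousZ (-1) ach.
  by rewrite (_ : (fun _ => _) = fun s => - h s)//; apply/funext => s; rewrite mulN1r.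
apply: (ae_imp _ aeh) => t Ht /Ht hd; exists 0 => //.
have := is_derive_scale (-1) hd; rewrite mulr0.
by rewrite (_ : (fun _ => _) = fun s => - h s)//; apply/funext => s; rewrite mulN1r.
Qed.

Section mismatch_matrix_theory.
Variables (R : realType) (alpha nu1 nu2 : R).
Hypotheses (halpha : 0 < alpha) (hnu1 : 0 < nu1) (hnu2 : 0 < nu2).
Let Rmx := mismatch_matrix alpha nu1 nu2.
Let kap := nu1 * nu2.

Let kap0 : 0 < kap. Proof. exact: mulr_gt0. Qed.

Definition mismatch_form (a b : R) : R :=
  (1 / (2 * alpha * nu1 * nu2)) *
  ((alpha ^+ 2 + nu1 * nu2 + (nu1 * nu2) ^+ 2) * (a * a) + 2 * alpha * (a * b)
   + (1 + nu1 * nu2) * (b * b)).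

Lemma sym_mismatch_matrix : Rmx^T = Rmx.
Proof. by rewrite /Rmx /mismatch_matrix linearZ /= tr_block_mx !tr_scalar_mx. Qed.

Lemma dot_mismatch_matrix (x : 'cV[R]_(1 + 1)) :
  dot x (Rmx *m x) = mismatch_form (x (lshift 1 0) 0) (x (rshift 1 0) 0).
Proof.
pose c := 1 / (2 * alpha * nu1 * nu2).
have E00 : Rmx (lshift 1 0) (lshift 1 0) =
    c * (alpha ^+ 2 + nu1 * nu2 + (nu1 * nu2) ^+ 2).
  by rewrite mxE block_mxEul mxE eqxx mulr1n.
have E01 : Rmx (lshift 1 0) (rshift 1 0) = c * alpha.
  by rewrite mxE block_mxEur mxE eqxx mulr1n.
have E10 : Rmx (rshift 1 0) (lshift 1 0) = c * alpha.
  by rewrite mxE block_mxEdl mxE eqxx mulr1n.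
have E11 : Rmx (rshift 1 0) (rshift 1 0) = c * (1 + nu1 * nu2).
  by rewrite mxE block_mxEdr mxE eqxx mulr1n.
rewrite /dot big_split_ord/= !big_ord1 ![(Rmx *m x) _ _]mxE !big_split_ord/=.
by rewrite !big_ord1 E00 E01 E10 E11 /mismatch_form -/c; ring.
Qed.

Lemma dot_pair (x : 'cV[R]_(1 + 1)) :
  dot x x = x (lshift 1 0) 0 ^+ 2 + x (rshift 1 0) 0 ^+ 2.
Proof. by rewrite /dot big_split_ord/= !big_ord1 !expr2. Qed.

Lemma mismatch_form_gt0 (a b : R) : 0 < a ^+ 2 + b ^+ 2 -> 0 < mismatch_form a b.
Proof.
move=> ab; rewrite /mismatch_form mulr_gt0//.
  by rewrite divr_gt0// !mulr_gt0.
rewrite -/kap (_ : _ + _ = (alpha * a + b) ^+ 2 + kap ^+ 2 * a ^+ 2 +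
  kap * (a ^+ 2 + b ^+ 2)); last by ring.
by rewrite ltr_wpDl ?mulr_gt0// addr_ge0 ?sqr_ge0// mulr_ge0 ?sqr_ge0.
Qed.

Lemma eigenvalue_mismatch_gt0 l : eigenvalue Rmx l -> 0 < l.
Proof.
move=> /(eigenvalue_rayleigh sym_mismatch_matrix)[x xR x0].
have := dot_mismatch_matrix x; rewrite xR => E.
by rewrite -(pmulr_lgt0 _ x0) E mismatch_form_gt0// -dot_pair.
Qed.

Lemma lambda_max_mismatch_gt0 : 0 < lambda_max Rmx.
Proof.
by have [/eigenvalue_mismatch_gt0] := lambda_maxP sym_mismatch_matrix isT.
Qed.

Lemma lambda_min_mismatch_gt0 : 0 < lambda_min Rmx.
Proof.
by have [/eigenvalue_mismatch_gt0] := lambda_minP sym_mismatch_matrix isT.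
Qed.

Let pair (a b : R) : 'cV[R]_(1 + 1) := col_mx a%:M b%:M.

Let pairl a b : pair a b (lshift 1 0) 0 = a.
Proof. by rewrite col_mxEu mxE eqxx mulr1n. Qed.

Let pairr a b : pair a b (rshift 1 0) 0 = b.
Proof. by rewrite col_mxEd mxE eqxx mulr1n. Qed.

Lemma mismatch_form_le a b : mismatch_form a b <= lambda_max Rmx * (a ^+ 2 + b ^+ 2).
Proof.
have [_ /(_ (pair a b))] := lambda_maxP sym_mismatch_matrix isT.
by rewrite dot_mismatch_matrix dot_pair pairl pairr.
Qed.

Lemma mismatch_form_ge a b : lambda_min Rmx * (a ^+ 2 + b ^+ 2) <= mismatch_form a b.
Proof.
have [_ /(_ (pair a b))] := lambda_minP sym_mismatch_matrix isT.
by rewrite dot_mismatch_matrix dot_pair pairl pairr.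
Qed.

(* mismatch_form is the Lyapunov function of x1' = x2, x2' = - alpha x2 - nu1 nu2 x1
   whose derivative is - (x1^2 + x2^2). *)
Lemma mismatch_decay (a b : R) (x1 x2 : R -> R) :
  a <= b -> abs_continuous a b (x1 : R -> R^o) ->
  abs_continuous a b (x2 : R -> R^o) ->
  {ae (@lebesgue_measure R), forall t, a < t < b ->
    is_derive t (1 : R) x1 (x2 t) /\
    is_derive t (1 : R) x2 (- alpha * x2 t - nu1 * nu2 * x1 t)} ->
  Num.sqrt (x1 b ^+ 2 + x2 b ^+ 2) <=
  Num.sqrt (lambda_max Rmx / lambda_min Rmx) *
  expR (- (1 / (2 * lambda_max Rmx)) * (b - a)) * Num.sqrt (x1 a ^+ 2 + x2 a ^+ 2).
Proof.
move=> ab ac1 ac2 aed.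
set lM := lambda_max Rmx; set lm := lambda_min Rmx.
have lM0 : 0 < lM := lambda_max_mismatch_gt0.
have lm0 : 0 < lm := lambda_min_mismatch_gt0.
pose q s := mismatch_form (x1 s) (x2 s).
have acq : abs_continuous a b (q : R -> R^o).
  rewrite /q /mismatch_form; apply: abs_continuousZ.
  by apply: abs_continuousD; [apply: abs_continuousD|];
    apply: abs_continuousZ; apply: abs_continuousM.
have ace : abs_continuous a b ((fun s => expR (lM^-1 * s)) : R -> R^o).
  by apply: abs_continuous_expR; apply: abs_continuousZ; exact: abs_continuous_id.
(* As [q <= lM (x1^2 + x2^2)], the derivative of [q] is at most [- q / lM]. *)
have h0 : expR (lM^-1 * b) * q b <= expR (lM^-1 * a) * q a.
  apply: (@abs_continuous_derive_le0 R (fun s => expR (lM^-1 * s) * q s)) => //.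
    exact: abs_continuousM.
  apply: (ae_imp _ aed) => t Ht /Ht[d1 d2].
  have dq := is_derive_scale (1 / (2 * alpha * nu1 * nu2)) (is_derive_add (is_derive_add
    (is_derive_scale (alpha ^+ 2 + nu1 * nu2 + (nu1 * nu2) ^+ 2) (is_derive_mul d1 d1))
    (is_derive_scale (2 * alpha) (is_derive_mul d1 d2)))
    (is_derive_scale (1 + nu1 * nu2) (is_derive_mul d2 d2))).
  have de := is_derive_exp (is_derive_scale lM^-1 (is_derive_id t (1 : R))).
  have := is_derive_mul de dq; set D := (X in is_derive _ _ _ X) => HD.
  exists D => //.
  have -> : D = expR (lM^-1 * t) * (lM^-1 * q t - (x1 t ^+ 2 + x2 t ^+ 2)).
    rewrite /D /q /mismatch_form; field.
    by rewrite !gt_eqF.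
  rewrite pmulr_rle0 ?expR_gt0// subr_le0 mulrC ler_pdivrMr// mulrC.
  exact: mismatch_form_le.
(* The quadratic form decays at rate [1 / lM], so the norm, its square root, decays at half that
   rate. This is the origin of the factor 2 in [c2]. *)
set e := expR (- (1 / (2 * lM)) * (b - a)).
have e0 : 0 < e by rewrite expR_gt0.
have ee : e ^+ 2 = expR (lM^-1 * a) / expR (lM^-1 * b).
  rewrite expr2 -expRD -expRN -expRD; congr expR; field.
  by rewrite gt_eqF.
have h1 : x1 b ^+ 2 + x2 b ^+ 2 <= lM / lm * e ^+ 2 * (x1 a ^+ 2 + x2 a ^+ 2).
  rewrite -(ler_pM2l lm0); apply: (le_trans (mismatch_form_ge _ _)).
  have h2 : q b <= e ^+ 2 * q a.
    by rewrite ee mulrAC ler_pdivlMr ?expR_gt0// mulrC.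
  apply: (le_trans h2).
  have -> : lm * (lM / lm * e ^+ 2 * (x1 a ^+ 2 + x2 a ^+ 2)) =
      e ^+ 2 * (lM * (x1 a ^+ 2 + x2 a ^+ 2)) by field; rewrite gt_eqF.
  by rewrite ler_pM2l ?exprn_gt0//; exact: mismatch_form_le.
have s0 : 0 <= lM / lm by rewrite divr_ge0// ltW.
apply: (le_trans (ler_wsqrtr h1)).
rewrite sqrtrM; last by rewrite mulr_ge0// sqr_ge0.
by rewrite sqrtrM// sqrtr_sqr gtr0_norm.
Qed.

End mismatch_matrix_theory.

Lemma sum_unitsE (R : realType) (n : nat) (V : {set 'I_n}) (x : 'I_n -> R) :
  sum_units V x = \sum_i restr V x i 0.
Proof. by rewrite /sum_units dotE dot_ones. Qed.

Lemma sum_units_in (R : realType) (n : nat) (V : {set 'I_n}) (x : 'I_n -> R) :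
  sum_units V x = \sum_(i in V) x i.
Proof.
by rewrite sum_unitsE (big_enum_val x); apply: eq_bigr => i _; rewrite mxE.
Qed.

Lemma abs_continuous_sum_units (R : realType) (n : nat) (V : {set 'I_n})
    (x : R -> 'I_n -> R) (a b : R) :
  abs_continuous a b (fun s => restr V (x s)) ->
  abs_continuous a b ((fun s => sum_units V (x s)) : R -> R^o).
Proof.
move=> acx; rewrite (_ : (fun _ => _) = fun s => \sum_i restr V (x s) i 0).
  by apply: abs_continuous_sum => i; exact: abs_continuous_coord.
by apply/funext => s; exact: sum_unitsE.
Qed.

Lemma is_derive_sum_units (R : realType) (n : nat) (V : {set 'I_n})
    (x : R -> 'I_n -> R) (t : R) d :
  is_derive t (1 : R) (fun s => restr V (x s)) d ->
  is_derive t (1 : R) (fun s => sum_units V (x s)) (\sum_i d i 0).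
Proof.
move=> dx; rewrite (_ : (fun _ => _) = fun s => \sum_i restr V (x s) i 0).
  by apply: is_derive_bigsum => i; exact: is_derive_coord.
by apply/funext => s; exact: sum_unitsE.
Qed.

(** * The summed dynamics during one phase *)

Section phase.
Variables (R : realType) (n : nat) (G : wdigraph R n) (r : 'I_n).
Variables (F : forall V : {set 'I_n}, 'cV[R]_#|V| -> R).
Variables (Pl alpha beta nu1 nu2 : R) (P z v : R -> 'I_n -> R).
Hypotheses (halpha : 0 < alpha) (hnu1 : 0 < nu1) (hnu2 : 0 < nu2).
Hypotheses (balG : weight_balanced G) (rG : r \in vertices G).
Let V := vertices G.
Let dyn t := dynamics_at F Pl alpha beta nu1 nu2 G r P z v t.

Lemma dynamics_sums t : dyn t ->
  [/\ is_derive t (1 : R) (fun s => sum_units V (P s)) (nu1 * sum_units V (z t)),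
      is_derive t (1 : R) (fun s => sum_units V (z s))
        (- alpha * sum_units V (z t) - sum_units V (v t)
         + nu2 * (Pl - sum_units V (P t)))
    & is_derive t (1 : R) (fun s => sum_units V (v s)) 0].
Proof.
move=> [g _ [dP dz dv]].
have er1 : \sum_i restr V (fun i => (i == r)%:R : R) i 0 = 1.
  rewrite -sum_unitsE sum_units_in (bigD1 r)//= eqxx big1 ?addr0// => i.
  by move=> /andP[_ /negbTE ->].
have Ls x := sum_laplacian_mul balG x.
split.
- have := is_derive_sum_units dP.
  rewrite (eq_bigr (fun i => nu1 * restr V (z t) i 0 - (laplacian G *m g) i 0)).
    by rewrite sumrB Ls subr0 -mulr_sumr sum_unitsE.
  by move=> i _; rewrite !mxE addrC.
- have := is_derive_sum_units dz.
  rewrite (eq_bigr (fun i => - alpha * restr V (z t) i 0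
     - beta * (laplacian G *m restr V (z t)) i 0 - restr V (v t) i 0
     + (nu2 * Pl * restr V (fun i => (i == r)%:R) i 0 - nu2 * restr V (P t) i 0))).
    rewrite big_split/= !sumrB -!mulr_sumr Ls er1 !sum_unitsE.
    by rewrite mulr0 subr0 mulr1 -mulrBr.
  move=> i _; move: (laplacian G *m restr V (z t)) => y.
  by rewrite !mxE; ring.
- have := is_derive_sum_units dv.
  rewrite (eq_bigr (fun i => (alpha * beta) * (laplacian G *m restr V (z t)) i 0)).
    by rewrite -mulr_sumr Ls mulr0.
  by move=> i _; rewrite mxE.
Qed.

Lemma phase_sum_v a b : a <= b -> abs_continuous a b (fun s => restr V (v s)) ->
  {ae (@lebesgue_measure R), forall t, a < t < b -> dyn t} ->
  sum_units V (v b) = sum_units V (v a).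
Proof.
move=> ab acv aed.
apply: (@abs_continuous_derive_eq0 R (fun s => sum_units V (v s))) => //.
  exact: abs_continuous_sum_units.
by apply: (ae_imp _ aed) => t Ht /Ht /dynamics_sums[].
Qed.

Let Rmx := mismatch_matrix alpha nu1 nu2.

Lemma phase_mismatch a b : a <= b ->
  abs_continuous a b (fun s => restr V (P s)) ->
  abs_continuous a b (fun s => restr V (z s)) ->
  abs_continuous a b (fun s => restr V (v s)) ->
  {ae (@lebesgue_measure R), forall t, a < t < b -> dyn t} ->
  sum_units V (v a) = 0 ->
  Num.sqrt ((sum_units V (P b) - Pl) ^+ 2 + (nu1 * sum_units V (z b)) ^+ 2) <=
  Num.sqrt (lambda_max Rmx / lambda_min Rmx) *
  expR (- (1 / (2 * lambda_max Rmx)) * (b - a)) *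
  Num.sqrt ((sum_units V (P a) - Pl) ^+ 2 + (nu1 * sum_units V (z a)) ^+ 2).
Proof.
move=> ab acP acz acv aed v0.
apply: (@mismatch_decay R alpha nu1 nu2 halpha hnu1 hnu2 a b
  (fun s => sum_units V (P s) - Pl) (fun s => nu1 * sum_units V (z s))) => //.
- apply: abs_continuousB; first exact: abs_continuous_sum_units.
  exact: (@abs_continuous_cst _ R^o).
- by apply: abs_continuousZ; exact: abs_continuous_sum_units.
apply: (ae_imp _ aed) => t Ht /[dup] /andP[at_ tb] /Ht /dynamics_sums[dP dz _].
(* The sum of [v] is constant on the phase, so its term disappears from the equation for the sum of
   [z]. *)
have vt : sum_units V (v t) = 0.
  rewrite -v0; apply: phase_sum_v (ltW at_) _ _.
    exact: abs_continuous_sub (lexx a) (ltW tb) acv.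
  apply: (ae_imp _ aed) => s Hs /andP[as_ st]; apply: Hs.
  by rewrite as_ (lt_trans st).
split.
- have := is_derive_sub dP (is_derive_const t Pl).
  by rewrite subr0.
- have := is_derive_scale nu1 dz; rewrite vt subr0.
  by rewrite (_ : nu1 * _ = - alpha * (nu1 * sum_units V (z t)) -
    nu1 * nu2 * (sum_units V (P t) - Pl)); last by ring.
Qed.

End phase.

(** * Sums of convex functions of one coordinate *)

Section separable_cost.
Variables (R : realType) (m : nat) (phi : 'I_m -> R -> R).
Hypotheses (phi0 : forall i u, 0 <= phi i u) (cphi : forall i, convex_real (phi i)).

Definition separable_cost (x : 'cV[R]_m) : R := \sum_i phi i (x i 0).

Lemma separable_cost_ge0 x : 0 <= separable_cost x.
Proof. by apply: sumr_ge0 => i _; exact: phi0. Qed.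

Lemma separable_cost_continuous : continuous separable_cost.
Proof.
have ci i : continuous (fun x : 'cV[R]_m => phi i (x i 0)).
  move=> x; apply: (@continuous_comp 'cV[R]_m R R (fun x => x i 0) (phi i)).
    exact: coord_continuous.
  exact: convex_real_continuous.
exact: (continuous_sum ci).
Qed.

Lemma separable_cost_convex x y t : 0 <= t -> t <= 1 ->
  separable_cost (t *: x + (1 - t) *: y) <=
  t * separable_cost x + (1 - t) * separable_cost y.
Proof.
move=> t0 t1; rewrite !mulr_sumr -big_split/=; apply: ler_sum => i _.
by rewrite !mxE; exact: cphi.
Qed.

Lemma separable_cost_subgradient x g w : clarke_gradient separable_cost x g ->
  dot g w <= separable_cost (x + w) - separable_cost x.
Proof.
apply: clarke_gradient_subgradient; first exact: separable_cost_convex.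
exact: separable_cost_continuous.
Qed.

(** A displacement along one axis changes a single term of the sum, so each coordinate of [g] is a
    subgradient of its own scalar term. *)
Lemma coord_subgradient x g i y : clarke_gradient separable_cost x g ->
  g i 0 * (y - x i 0) <= phi i y - phi i (x i 0).
Proof.
move=> /(separable_cost_subgradient ((y - x i 0) *: delta_mx i 0)).
have -> : dot g ((y - x i 0) *: delta_mx i 0) = g i 0 * (y - x i 0).
  rewrite dotZr /dot (bigD1 i)//= big1 => [|j /negbTE ji].
    by rewrite !mxE !eqxx mulr1 addr0 mulrC.
  by rewrite mxE ji mulr0.
have E : separable_cost (x + (y - x i 0) *: delta_mx i 0) =
    separable_cost x + (phi i y - phi i (x i 0)).
  rewrite /separable_cost (bigD1 i)//= [in RHS](bigD1 i)//=.
  rewrite !mxE !eqxx mulr1 [x i 0 + _]addrC subrK.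
  rewrite (eq_bigr (fun j => phi j (x j 0))) => [|j /negbTE ji]; first by ring.
  by rewrite !mxE ji mulr0 addr0.
by rewrite E [_ + (_ - _)]addrC addrK.
Qed.

(** On a compact time interval the coordinates stay in a bounded range, where the convex terms are
    Lipschitz. *)
Lemma abs_continuous_separable_cost (a b : R) (x : R -> 'cV[R]_m) :
  abs_continuous a b x ->
  abs_continuous a b ((fun s => separable_cost (x s)) : R -> R^o).
Proof.
move=> acx; apply: abs_continuous_sum => i.
have acxi := abs_continuous_coord i acx.
have [B B0 HB] := abs_continuous_bounded acxi.
have K0 : 0 < phi i (B + 1) + phi i (- B - 1) + 1 by rewrite ltr_wpDl// addr_ge0.
apply: (abs_continuous_lipschitz acxi K0) => u w au uw wb.
apply: (@le_trans _ _ ((phi i (B + 1) + phi i (- B - 1)) * `|x w i 0 - x u i 0|)).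
  apply: convex_real_lipschitz => //; apply: HB => //.
    exact: le_trans uw wb.
  exact: le_trans au uw.
by apply: ler_wpM2r => //; rewrite lerDl.
Qed.

Lemma exists_coord_le (x : 'cV[R]_m) K : (0 < m)%N -> 0 <= K ->
  \sum_i x i 0 <= K -> exists i, x i 0 <= K.
Proof.
move=> m0 K0 xK; apply: contrapT => /forallNP H.
have : \sum_(i < m) K < \sum_i x i 0.
  apply: ltr_sum => [|i _]; last by rewrite ltNge; apply/negP; exact: H.
  by apply/hasP; exists (Ordinal m0); rewrite ?mem_index_enum.
rewrite sumr_const card_ord ltNge => /negP; apply.
by apply: (le_trans xK); rewrite -mulr_natr ler_peMr// ler1n.
Qed.

Lemma sqr_dev_le (x : 'cV[R]_m) i : (mean x - x i 0) ^+ 2 <= dot (dev x) (dev x).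
Proof.
rewrite /dot (bigD1 i)//= !mxE mulr1 -expr2 -[leLHS]sqrrN opprB lerDl.
by apply: sumr_ge0 => j _; rewrite -expr2 sqr_ge0.
Qed.

(* As the coordinates of x have a bounded sum, one of them is bounded above and
   one is bounded below; the corresponding partial subgradients are then bounded
   on one side, and the others differ from them by at most the deviation of g. *)
Lemma mean_subgradient_bound (K : R) : (0 < m)%N -> 0 <= K ->
  exists2 C : R, 0 <= C & forall x g, clarke_gradient separable_cost x g ->
    `|\sum_i x i 0| <= K -> `|mean g| <= C + Num.sqrt (dot (dev g) (dev g)).
Proof.
move=> m0 K0; pose C := \sum_i (phi i (K + 1) + phi i (- K - 1)).
have Ci i : phi i (K + 1) + phi i (- K - 1) <= C.
  rewrite /C (bigD1 i)//= lerDl; apply: sumr_ge0 => j _.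
  by rewrite addr_ge0.
exists C; first by apply: sumr_ge0 => i _; rewrite addr_ge0.
move=> x g xg; rewrite ler_norml => /andP[Kx xK].
have dg i : `|mean g - g i 0| <= Num.sqrt (dot (dev g) (dev g)).
  by rewrite -sqrtr_sqr; apply: ler_wsqrtr; exact: sqr_dev_le.
have [i xi] := exists_coord_le m0 K0 xK.
have [j xj] : exists j, (- x) j 0 <= K.
  apply: exists_coord_le => //.
  by rewrite (eq_bigr (fun i => - x i 0)) ?sumrN; [lra | move=> k _; rewrite mxE].
rewrite mxE in xj; have {}xj : - K <= x j 0 by lra.
have gi := subgradient_le (phi0 i) (fun y => coord_subgradient i y xg) xi.
have gj := subgradient_ge (phi0 j) (fun y => coord_subgradient j y xg) xj.
have := dg i; have := dg j; rewrite !ler_norml => /andP[d1 _] /andP[_ d2].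
have := Ci i; have := Ci j; have := phi0 i (- K - 1); have := phi0 j (K + 1).
by move=> ? ? ? ?; apply/andP; split; lra.
Qed.

End separable_cost.

(** The square of [2 c x - y] is nonnegative. *)
Lemma young_dot (R : realType) (m : nat) (x y : 'cV[R]_m) c : 0 < c ->
  dot x y <= c * dot x x + (4 * c)^-1 * dot y y.
Proof.
move=> c0; have := dot_ge0 ((2 * c) *: x - y).
rewrite !dotDl !dotDr !dotNl !dotNr !dotZl !dotZr (dotC y x) => H.
rewrite -(ler_pM2l (mulr_gt0 (ltr0n R 4) c0)) mulrDr mulVKf.
  by lra.
by rewrite mulf_neq0 ?pnatr_eq0// gt_eqF.
Qed.

(** * The dissipation inequality *)

Section dissipation.
Variables (R : realType) (n : nat) (G : wdigraph R n).
Hypotheses (balG : weight_balanced G) (conG : strongly_connected G).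
Variables (alpha beta nu1 nu2 : R).
Hypotheses (halpha : 0 < alpha) (hbeta : 0 < beta).
Hypotheses (hnu1 : 0 < nu1) (hnu2 : 0 < nu2).
Let m := #|vertices G|.
Let L := laplacian G.
Let lambda2 := lambda_two (L + L^T).
Hypothesis m0 : (0 < m)%N.
Hypothesis gains : nu1 / (beta * nu2 * lambda2)
  + nu2 ^+ 2 * lambda_max (L^T *m L) / (2 * alpha) < lambda2.

(** The left-hand side is the derivative of the three terms of W along the dynamics, with the cost
    replaced by its linear minorant of slope [g]. *)
Lemma dissipation : exists2 kappa : R, 0 < kappa & forall g z xi : 'cV[R]_m,
  dot g (- (L *m g) + nu1 *: z)
  + nu1 * nu2 * dot z (- (beta *: (L *m z)) - xi)
  + dot xi (- (alpha *: xi) + nu2 *: (- (L *m g) + nu1 *: z)) <=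
  - kappa * (dot (dev g) (dev g) + dot (dev z) (dev z) + dot xi xi)
  + nu1 * (mean g * \sum_i z i 0).
Proof.
move: gains; set A := nu1 / (beta * nu2 * lambda2).
set B := nu2 ^+ 2 * lambda_max (L^T *m L) / (2 * alpha) => AB.
have Lam0 : 0 <= lambda_max (L^T *m L) := lambda_max_gram_ge0 m0.
have l20 : 0 <= lambda2 := lambda_two_laplacian_ge0 balG.
(* Nonnegativity holds even for [lambda2 = 0], by the convention on inverses; the gain condition
   then forces [lambda2 > 0]. *)
have A0 : 0 <= A by rewrite divr_ge0 ?mulr_ge0// ltW.
have B0 : 0 <= B by rewrite divr_ge0 ?mulr_ge0 ?sqr_ge0// ltW.
have l2 : 0 < lambda2 by lra.
have {}A0 : 0 < A by rewrite divr_gt0// !mulr_gt0.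
(* The factor tau < 1 leaves some slack in both uses of Young's inequality. *)
pose tau := (lambda2 + A + B) / (2 * lambda2).
have tau0 : 0 < tau by rewrite divr_gt0 ?mulr_gt0//; lra.
have tau1 : tau < 1 by rewrite ltr_pdivrMr ?mulr_gt0//; lra.
pose B1 := nu1 * nu2 * beta * lambda2 / 2.
have B10 : 0 < B1 by rewrite divr_gt0// !mulr_gt0.
(* [tau] is the midpoint of [(A + B) / lambda2] and 1, hence larger than the former. *)
have ABt : (A + B) / tau < lambda2.
  rewrite ltr_pdivrMr// /tau.
  have -> : lambda2 * ((lambda2 + A + B) / (2 * lambda2)) = (lambda2 + A + B) / 2.
    by field; rewrite gt_eqF.
  by lra.
clearbody tau.
pose k1 := (lambda2 - (A + B) / tau) / 2.
have k10 : 0 < k1 by rewrite divr_gt0// subr_gt0.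
pose k2 := (1 - tau) * B1; have k20 : 0 < k2 by rewrite mulr_gt0// subr_gt0.
pose k3 := (1 - tau) * alpha; have k30 : 0 < k3 by rewrite mulr_gt0// subr_gt0.
exists (Num.min k1 (Num.min k2 k3)); first by rewrite !lt_min k10 k20.
move=> g z xi; set kap := Num.min _ _.
have kk1 : kap <= k1 by rewrite ge_min lexx.
have kk2 : kap <= k2 by rewrite !ge_min lexx orbT.
have kk3 : kap <= k3 by rewrite !ge_min lexx !orbT.
have Gd0 := dot_ge0 (dev g); have Zd0 := dot_ge0 (dev z); have X0 := dot_ge0 xi.
have hg := dot_dev_laplacian balG g m0 conG; rewrite -/L -/lambda2 in hg.
have hz := dot_dev_laplacian balG z m0 conG; rewrite -/L -/lambda2 in hz.
have hL := norm_laplacian_dev g m0; rewrite -/L in hL.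
(* The coefficients are chosen so that the products consume exactly the fraction [tau] of the
   dissipation in [dev z] and in [xi]. The remainders are [A / (2 tau)] and [B / (2 tau)] times
   [|dev g|^2], to be covered by [lambda2 / 2]. *)
have y1 := young_dot (dev z) (dev g) (divr_gt0 (mulr_gt0 tau0 B10) hnu1).
have y2 := young_dot xi (- (L *m g)) (divr_gt0 (mulr_gt0 tau0 halpha) hnu2).
rewrite dotNr dotNl dotNr opprK in y2.
have gz : dot g z = dot (dev z) (dev g) + mean g * \sum_i z i 0.
  by rewrite (dotC (dev z)) dot_dev /mean; ring.
move: Gd0 Zd0 X0 hg hz hL y1 y2 gz.
move: (dev g) (dev z) => dg dz.
rewrite !dotDr !dotNr !dotZr !dotDr !dotNr !dotZr (dotC z xi).
move: (dot dg dg) (dot dz dz) (dot xi xi) (dot g (L *m g))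
  (dot z (L *m z)) (dot (L *m g) (L *m g)) (dot dz dg) (dot xi (L *m g))
  (dot g z) (dot xi z) (mean g * _) => Gd Zd X gLg zLz LL zg xL gz xz ms.
move=> Gd0 Zd0 X0 hg hz hL y1 y2 ->.
have {}y1 : nu1 * zg <= tau * B1 * Zd + A / (2 * tau) * Gd.
  have := ler_wpM2l (ltW hnu1) y1.
  rewrite (_ : nu1 * (_ + _) = tau * B1 * Zd + A / (2 * tau) * Gd)//.
  by rewrite /A /B1; field; rewrite !gt_eqF.
have {}y2 : - (nu2 * xL) <= tau * alpha * X + B / (2 * tau) * Gd.
  have := ler_wpM2l (ltW hnu2) y2; rewrite mulrN => /le_trans; apply.
  have c0 : 0 <= nu2 ^+ 2 / (4 * tau * alpha).
    by rewrite divr_ge0 ?sqr_ge0// !mulr_ge0// ltW.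
  have := ler_wpM2l c0 hL.
  rewrite (_ : nu2 * (tau * alpha / nu2 * X + (4 * (tau * alpha / nu2))^-1 * LL) =
    tau * alpha * X + nu2 ^+ 2 / (4 * tau * alpha) * LL); last first.
    by field; rewrite !gt_eqF.
  rewrite (_ : nu2 ^+ 2 / (4 * tau * alpha) * (_ * Gd) = B / (2 * tau) * Gd).
    by rewrite lerD2l.
  by rewrite /B; field; rewrite !gt_eqF.
have {}hz : B1 * Zd <= nu1 * nu2 * beta * zLz.
  have := ler_wpM2l (ltW (mulr_gt0 (mulr_gt0 hnu1 hnu2) hbeta)) hz.
  by congr (_ <= _); rewrite /B1; ring.
have e1 : kap * Gd <= (lambda2 / 2 - A / (2 * tau) - B / (2 * tau)) * Gd.
  apply: ler_wpM2r => //; apply: le_trans kk1 _; rewrite /k1 le_eqVlt.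
  by apply/orP; left; apply/eqP; field; rewrite gt_eqF.
have e2 : kap * Zd <= k2 * Zd by apply: ler_wpM2r.
have e3 : kap * X <= k3 * X by apply: ler_wpM2r.
rewrite /k2 in e2; rewrite /k3 in e3.
by lra.
Qed.

End dissipation.

(** * Convergence between events *)

Lemma is_derive_dot_self (R : realType) (m : nat) (x : R -> 'cV[R]_m)
    (t : R) (d : 'cV[R]_m) :
  (forall i, is_derive t (1 : R) (fun s => x s i 0) (d i 0)) ->
  is_derive t (1 : R) (fun s => dot (x s) (x s)) (2 * dot (x t) d).
Proof.
move=> dx; have := is_derive_bigsum (fun i => is_derive_mul (dx i) (dx i)).
rewrite (eq_bigr (fun i => 2 * (x t i 0 * d i 0))) => [|i _]; last by ring.
by rewrite -mulr_sumr.
Qed.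

Lemma is_derive_dotl (R : realType) (m : nat) (g : 'cV[R]_m) (x : R -> 'cV[R]_m)
    (t : R) (d : 'cV[R]_m) :
  (forall i, is_derive t (1 : R) (fun s => x s i 0) (d i 0)) ->
  is_derive t (1 : R) (fun s => dot g (x s)) (dot g d).
Proof.
by move=> dx; exact: is_derive_bigsum (fun i => is_derive_scale (g i 0) (dx i)).
Qed.

Lemma abs_continuous_dot_self (R : realType) (m : nat) (x : R -> 'cV[R]_m) (a b : R) :
  (forall i, abs_continuous a b ((fun s => x s i 0) : R -> R^o)) ->
  abs_continuous a b ((fun s => dot (x s) (x s)) : R -> R^o).
Proof.
by move=> acx; apply: abs_continuous_sum => i; exact: abs_continuousM.
Qed.

Lemma expR_decay (R : realType) (c t0 e : R) : 0 < c -> 0 < e ->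
  exists2 T, t0 <= T & forall t, T <= t -> expR (- c * (t - t0)) <= e.
Proof.
move=> c0 e0; exists (t0 + `|ln e| / c).
  by rewrite lerDl divr_ge0// ltW.
move=> t Tt; rewrite -[leRHS](@lnK R e)// ler_expR.
have h : `|ln e| / c <= t - t0 by lra.
move: h; rewrite ler_pdivrMr// => h.
have := ler_norm (- ln e); rewrite normrN; lra.
Qed.

Section convergence.
Variables (R : realType) (n : nat) (G : wdigraph R n) (r : 'I_n).
Hypotheses (balG : weight_balanced G) (conG : strongly_connected G).
Hypothesis rG : r \in vertices G.
Let V := vertices G.
Let L := laplacian G.
Variable phi : 'I_#|V| -> R -> R.
Hypotheses (phi0 : forall i u, 0 <= phi i u) (cphi : forall i, convex_real (phi i)).
Hypothesis phi_coercive : forall M, exists B : R, forall x,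
  separable_cost phi x <= M -> forall i, `|x i 0| <= B.
Variables (F : forall V : {set 'I_n}, 'cV[R]_#|V| -> R).
Hypothesis FE : F (V := V) = separable_cost phi.
Variables (Pl alpha beta nu1 nu2 : R) (P z v : R -> 'I_n -> R).
Hypotheses (halpha : 0 < alpha) (hbeta : 0 < beta).
Hypotheses (hnu1 : 0 < nu1) (hnu2 : 0 < nu2).
Hypothesis gains : nu1 / (beta * nu2 * lambda_two (L + L^T))
  + nu2 ^+ 2 * lambda_max (L^T *m L) / (2 * alpha) < lambda_two (L + L^T).
Variable t0 : R.
Hypothesis acP : forall T, t0 <= T -> abs_continuous t0 T (fun s => restr V (P s)).
Hypothesis acz : forall T, t0 <= T -> abs_continuous t0 T (fun s => restr V (z s)).
Hypothesis acv : forall T, t0 <= T -> abs_continuous t0 T (fun s => restr V (v s)).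
Hypothesis aed : {ae (@lebesgue_measure R), forall t, t0 < t ->
  dynamics_at F Pl alpha beta nu1 nu2 G r P z v t}.
Hypothesis v0 : sum_units V (v t0) = 0.

Let m0 : (0 < #|V|)%N. Proof. by apply/card_gt0P; exists r. Qed.

Let p s := restr V (P s).
Let zt s := restr V (z s).
Let er : 'cV[R]_#|V| := restr V (fun i => (i == r)%:R).
(* With xi the equations read z' = - beta L z - xi, xi' = - alpha xi + nu2 P'. *)
Let xi s := restr V (v s) + alpha *: zt s - nu2 *: (Pl *: er - p s).
Let D (g : 'cV[R]_#|V|) t :=
  dot (dev g) (dev g) + dot (dev (zt t)) (dev (zt t)) + dot (xi t) (xi t).

Lemma mismatch_vanishes : exists C c : R, [/\ 0 <= C, 0 < c
  & forall t, t0 <= t -> `|\sum_i p t i 0 - Pl| <= C * expR (- c * (t - t0)) /\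
      `|nu1 * \sum_i zt t i 0| <= C * expR (- c * (t - t0))].
Proof.
set Rmx := mismatch_matrix alpha nu1 nu2.
have lM := lambda_max_mismatch_gt0 halpha hnu1 hnu2.
exists (Num.sqrt (lambda_max Rmx / lambda_min Rmx) *
  Num.sqrt ((sum_units V (P t0) - Pl) ^+ 2 + (nu1 * sum_units V (z t0)) ^+ 2)).
exists (1 / (2 * lambda_max Rmx)); split.
- by rewrite mulr_ge0// sqrtr_ge0.
- by rewrite divr_gt0// mulr_gt0.
move=> t tt0.
have aet : {ae (@lebesgue_measure R), forall s, t0 < s < t ->
    dynamics_at F Pl alpha beta nu1 nu2 G r P z v s}.
  by apply: (ae_imp _ aed) => s Hs /andP[/Hs].
have := phase_mismatch halpha hnu1 hnu2 balG rG tt0 (acP tt0) (acz tt0) (acv tt0) aet v0.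
rewrite -/Rmx mulrAC !sum_unitsE => H.
split; apply: le_trans H; rewrite -sqrtr_sqr; apply: ler_wsqrtr.
  by rewrite lerDl sqr_ge0.
by rewrite lerDr sqr_ge0.
Qed.

Lemma state_derivatives t : dynamics_at F Pl alpha beta nu1 nu2 G r P z v t ->
  exists2 g, clarke_gradient (separable_cost phi) (p t) g &
  [/\ forall i, is_derive t (1 : R) (fun s => p s i 0) ((- (L *m g) + nu1 *: zt t) i 0),
      forall i, is_derive t (1 : R) (fun s => zt s i 0)
        ((- (beta *: (L *m zt t)) - xi t) i 0)
    & forall i, is_derive t (1 : R) (fun s => xi s i 0)
        ((- (alpha *: xi t) + nu2 *: (- (L *m g) + nu1 *: zt t)) i 0)].
Proof.
move=> [g gF [dP dz dv]]; exists g; first by rewrite -FE.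
have hz i : is_derive t (1 : R) (fun s => zt s i 0)
    ((- (beta *: (L *m zt t)) - xi t) i 0).
  have := is_derive_coord i dz; congr is_derive.
  rewrite /xi -/V -/er -/L -/(zt t) -/(p t).
  by move: (L *m zt t) (zt t) (restr V (v t)) (p t) er => a b c d e; rewrite !mxE; ring.
have hP i := is_derive_coord i dP.
split => // i.
have hv := is_derive_coord i dv.
have hx := is_derive_sub (is_derive_add hv (is_derive_scale alpha (hz i)))
  (is_derive_scale nu2 (is_derive_sub (is_derive_const t (Pl * er i 0)) (hP i))).
rewrite [X in is_derive _ _ X _](_ : _ = fun s => restr V (v s) i 0 +
    alpha * zt s i 0 - nu2 * (Pl * er i 0 - p s i 0)); last first.
  by apply/funext => s; rewrite !mxE.
move: hx; congr is_derive; rewrite -/V -/L -/(zt t) -/(p t).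
by move: (L *m zt t) (L *m g) (zt t) (xi t) => a b c d; rewrite !mxE; ring.
Qed.

Lemma abs_continuous_xi a b i : t0 <= a -> a <= b ->
  abs_continuous a b ((fun s => xi s i 0) : R -> R^o).
Proof.
move=> ta ab; have tb := le_trans ta ab.
rewrite (_ : (fun _ => _) = fun s => restr V (v s) i 0 +
    alpha * zt s i 0 - nu2 * (Pl * er i 0 - p s i 0)); last first.
  by apply/funext => s; rewrite !mxE.
apply: abs_continuousB; [apply: abs_continuousD|].
- by apply: abs_continuous_coord; exact: abs_continuous_sub ta (lexx b) (acv tb).
- apply: abs_continuousZ.
  by apply: abs_continuous_coord; exact: abs_continuous_sub ta (lexx b) (acz tb).
apply: abs_continuousZ; apply: abs_continuousB.
  exact: (@abs_continuous_cst _ R^o).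
by apply: abs_continuous_coord; exact: abs_continuous_sub ta (lexx b) (acP tb).
Qed.

(* The means of g and z prevent W = f(P) + (nu1 nu2 |z|^2 + |xi|^2) / 2 from being
   decreasing; as the mean of z decays exponentially, the term K E compensates. *)
Lemma lyapunov_decrease : exists W : R -> R, exists kappa K C : R, exists E : R -> R,
  [/\ 0 < kappa, 0 <= K, 0 <= C,
      (forall e, 0 < e -> exists2 T, t0 <= T & forall t, T <= t -> E t <= e)
    & [/\ forall t, W t = separable_cost phi (p t) + nu1 * nu2 / 2 * dot (zt t) (zt t)
          + 1 / 2 * dot (xi t) (xi t) + K * E t,
        forall t, t0 <= t -> [/\ 0 <= E t, E t <= 1,
          `|\sum_i p t i 0 - Pl| <= C * E t & `|nu1 * \sum_i zt t i 0| <= C * E t],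
        forall t g, t0 <= t -> clarke_gradient (separable_cost phi) (p t) g ->
          `|mean g| <= C + Num.sqrt (dot (dev g) (dev g))
      & forall a b eta, t0 <= a -> a <= b -> 0 <= eta ->
        (forall t g, a < t < b -> clarke_gradient (separable_cost phi) (p t) g ->
           eta <= D g t) ->
        W b <= W a - kappa * eta * (b - a)]].
Proof.
have [C0 [c [C00 c0 HC0]]] := mismatch_vanishes.
have K0 : 0 <= `|Pl| + C0 by rewrite addr_ge0.
have [C1 C10 HC1] := mean_subgradient_bound phi0 cphi m0 K0.
have [kap2 kap20 Hdis] := dissipation balG conG halpha hbeta hnu1 hnu2 m0 gains.
(* Half of the dissipation is set aside to absorb the mean term. *)
pose kap := kap2 / 2; have kap0 : 0 < kap by rewrite divr_gt0.
pose E t := expR (- c * (t - t0)).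
(* With [s = |dev g|], the mean term is at most [(C + s) C E <= kap s^2 + K' E], using [E^2 <= E].
   Since [E' = - c E], the choice [K = K' / c] makes the derivative of [K E] equal to [- K' E]. *)
pose C := C0 + C1; pose K' := C * C + C ^+ 2 / (4 * kap); pose K := K' / c.
have C_ge0 : 0 <= C by rewrite addr_ge0.
have K'0 : 0 <= K'.
  by rewrite addr_ge0 ?mulr_ge0// ?sqr_ge0// invr_ge0 mulr_ge0// ltW.
have E0 t : 0 <= E t by rewrite expR_ge0.
have E1 t : t0 <= t -> E t <= 1.
  by move=> tt; rewrite -expR0 ler_expR mulNr oppr_le0 mulr_ge0 ?subr_ge0// ltW.
have HE t : t0 <= t -> [/\ 0 <= E t, E t <= 1, `|\sum_i p t i 0 - Pl| <= C * E t
    & `|nu1 * \sum_i zt t i 0| <= C * E t].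
  move=> tt; have [h1 h2] := HC0 t tt.
  have CC : C0 * E t <= C * E t by rewrite ler_wpM2r// lerDl.
  by split => //; [exact: E1 | exact: le_trans h1 CC | exact: le_trans h2 CC].
have Hm t g : t0 <= t -> clarke_gradient (separable_cost phi) (p t) g ->
    `|mean g| <= C + Num.sqrt (dot (dev g) (dev g)).
  move=> tt gF; have [h1 _] := HC0 t tt.
  have CE : C0 * expR (- c * (t - t0)) <= C0 by rewrite ler_piMr// E1.
  apply: (le_trans (HC1 (p t) g gF _)).
    rewrite -[X in `|X|](subrK Pl) (le_trans (ler_normD _ _))// addrC lerD2l.
    exact: le_trans h1 CE.
  by rewrite lerD2r lerDr.
exists (fun t => separable_cost phi (p t) + nu1 * nu2 / 2 * dot (zt t) (zt t)
          + 1 / 2 * dot (xi t) (xi t) + K * E t).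
exists kap, K, C, E; split => //.
- by rewrite divr_ge0// ltW.
- by move=> e e0; exact: expR_decay.
split => // a b eta ta ab eta0 Heta.
have tb := le_trans ta ab.
(* The linear term in [s] turns the claimed rate of decrease into plain monotonicity. *)
pose h s := separable_cost phi (p s) + nu1 * nu2 / 2 * dot (zt s) (zt s)
          + 1 / 2 * dot (xi s) (xi s) + K * E s + kap * eta * s.
suff : h b <= h a by rewrite /h; lra.
have acPa := abs_continuous_sub ta (lexx b) (acP tb).
have acza := abs_continuous_sub ta (lexx b) (acz tb).
apply: (@abs_continuous_nonincreasing R h a b ab).
  rewrite /h /E; apply: abs_continuousD; last first.
    by apply: abs_continuousZ; exact: abs_continuous_id.
  apply: abs_continuousD; last first.
    apply: abs_continuousZ; apply: abs_continuous_expR; apply: abs_continuousZ.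
    apply: abs_continuousB; first exact: abs_continuous_id.
    exact: (@abs_continuous_cst _ R^o).
  apply: abs_continuousD; last first.
    apply: abs_continuousZ; apply: abs_continuous_dot_self => i.
    exact: abs_continuous_xi.
  apply: abs_continuousD.
    exact: abs_continuous_separable_cost.
  apply: abs_continuousZ; apply: abs_continuous_dot_self => i.
  exact: abs_continuous_coord.
apply: (ae_imp _ aed) => t Ht /[dup] /andP[at_ tb'] tab.
have tt0 : t0 < t by exact: le_lt_trans ta at_.
have [g gF [dp dz dx]] := state_derivatives (Ht tt0).
(* The convex cost is replaced by its supporting linear function at [p t]. The result is
   differentiable at [t], and by the subgradient inequality its increments up to [t] dominate those
   of [h]. *)
pose k s := dot g (p s) + nu1 * nu2 / 2 * dot (zt s) (zt s)
          + 1 / 2 * dot (xi s) (xi s) + K * E s + kap * eta * s.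
have dE := is_derive_exp (is_derive_scale (- c)
  (is_derive_sub (is_derive_id t (1 : R)) (is_derive_const t t0))).
have dk := is_derive_add (is_derive_add (is_derive_add (is_derive_add
  (is_derive_dotl g dp) (is_derive_scale (nu1 * nu2 / 2) (is_derive_dot_self dz)))
  (is_derive_scale (1 / 2) (is_derive_dot_self dx))) (is_derive_scale K dE))
  (is_derive_scale (kap * eta) (is_derive_id t (1 : R))).
exists k; eexists; split; first exact: dk.
- have hD := Heta t g tab gF.
  have := Hdis g (zt t) (xi t).
  have [_ Et1 _ hz] := HE t (ltW tt0).
  have hm := Hm t g (ltW tt0) gF.
  have Et0 := E0 t.
  have hx : nu1 * (mean g * \sum_i zt t i 0) <=
      kap * dot (dev g) (dev g) + K' * E t.
    apply: (le_trans (ler_norm _)).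
    rewrite mulrCA normrM.
    apply: (le_trans (ler_pM _ _ hm hz)) => //.
    have s0 := sqrtr_ge0 (dot (dev g) (dev g)).
    have ss := sqr_sqrtr (dot_ge0 (dev g)).
    move: s0 ss; set s := Num.sqrt _ => s0 <-.
    have y0 : 0 <= C * E t by rewrite mulr_ge0.
    have yy : (C * E t) ^+ 2 <= C ^+ 2 * E t.
      by rewrite exprMn ler_wpM2l ?sqr_ge0// expr2 ler_piMl.
    have am : s * (C * E t) <= kap * s ^+ 2 + (C * E t) ^+ 2 / (4 * kap).
      rewrite -subr_ge0.
      have -> : kap * s ^+ 2 + (C * E t) ^+ 2 / (4 * kap) - s * (C * E t) =
        kap * (s - C * E t / (2 * kap)) ^+ 2 by field; rewrite gt_eqF.
      by rewrite mulr_ge0 ?sqr_ge0// ltW.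
    have : (C * E t) ^+ 2 / (4 * kap) <= C ^+ 2 / (4 * kap) * E t.
      by rewrite [leRHS]mulrAC ler_wpM2r// invr_ge0 mulr_ge0// ltW.
    rewrite /K'; lra.
  have kD : kap * eta <= kap * D g t by rewrite ler_pM2l.
  have KE : K * (expR (- c * (t - t0)) * (- c * (1 - 0))) = - (K' * E t).
    by rewrite /K /E; field; rewrite gt_eqF.
  have Zx0 : 0 <= dot (dev (zt t)) (dev (zt t)) + dot (xi t) (xi t).
    by rewrite addr_ge0 ?dot_ge0.
  have kz := mulr_ge0 (ltW kap0) Zx0.
  have k2 : kap2 = 2 * kap by rewrite mulrC divfK.
  rewrite k2 /D in kD *; rewrite KE.
  move: (dot g _) (dot (zt t) _) (dot (xi t) (_ + _)) => X Y Z' hdis.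
  by lra.
move=> y ay yt.
have := separable_cost_subgradient phi0 cphi (p y - p t) gF.
rewrite [p t + _]addrC subrK dotDr dotNr.
by rewrite /h /k; lra.
Qed.

(** The cost is at most [W], which never exceeds its initial value, and the sublevel sets of the
    cost are bounded. *)
Lemma state_bounded : exists B : R, forall t, t0 <= t -> forall i, `|p t i 0| <= B.
Proof.
have [W [kap [K [C [E [k0 K0 C0 _ [WE HE _ Hdec]]]]]]] := lyapunov_decrease.
have [B HB] := phi_coercive (W t0); exists B => t tt; apply: HB.
have WW : W t <= W t0.
  have := Hdec t0 t 0 (lexx _) tt (lexx _); rewrite mulr0 mul0r subr0; apply.
  by move=> s g _ _; rewrite /D !addr_ge0 ?dot_ge0.
apply: le_trans WW; rewrite WE.
have h1 : 0 <= nu1 * nu2 / 2 * dot (zt t) (zt t).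
  by rewrite mulr_ge0 ?dot_ge0// divr_ge0// mulr_ge0// ltW.
have h2 := dot_ge0 (xi t).
have h3 : 0 <= K * E t by rewrite mulr_ge0//; case: (HE t tt).
by lra.
Qed.

Lemma mismatch_cvg0 (e : R) : 0 < e ->
  exists2 T, t0 <= T & forall t, T <= t -> `|\sum_i p t i 0 - Pl| <= e.
Proof.
move=> e0; have [W [kap [K [C [E [k0 K0 C0 cE [_ HE _ _]]]]]]] := lyapunov_decrease.
have [T tT HT] := cE (e / (C + 1)) (divr_gt0 e0 (ltr_wpDl C0 ltr01)).
exists T => // t Tt; have [Et0 _ h _] := HE t (le_trans tT Tt).
apply: (le_trans h); have := HT t Tt; rewrite ler_pdivlMr ?ltr_wpDl//.
by move=> h2; rewrite mulrC; lra.
Qed.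

(* W decreases at rate at least kappa * D, so D is small at arbitrarily late
   times; there g is nearly a multiple of the all-ones vector, and the subgradient
   inequality bounds W, hence all later costs, by nearly the cost of Q. *)
Lemma cost_limsup (Q : 'cV[R]_#|V|) (eta : R) : \sum_i Q i 0 = Pl -> 0 < eta ->
  exists2 T, t0 <= T &
    forall t, T <= t -> separable_cost phi (p t) <= separable_cost phi Q + eta.
Proof.
move=> Q1 eta0.
have [W [kap [K [C [E [kap0 K0 C0 cE [WE HE Hm Hdec]]]]]]] := lyapunov_decrease.
have W_ge t : t0 <= t -> separable_cost phi (p t) <= W t.
  move=> tt; rewrite WE.
  have h1 : 0 <= nu1 * nu2 / 2 * dot (zt t) (zt t).
    by rewrite mulr_ge0 ?dot_ge0// divr_ge0// mulr_ge0// ltW.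
  have h2 := dot_ge0 (xi t).
  have h3 : 0 <= K * E t by rewrite mulr_ge0//; case: (HE t tt).
  by lra.
have W_dec s t : t0 <= s -> s <= t -> W t <= W s.
  move=> ts st; have := Hdec s t 0 ts st (lexx _); rewrite mulr0 mul0r subr0; apply.
  by move=> u g _ _; rewrite /D !addr_ge0 ?dot_ge0.
have late delta T : 0 < delta -> t0 <= T -> exists t g,
    [/\ T <= t, clarke_gradient (separable_cost phi) (p t) g & D g t < delta].
  move=> d0 tT; apply: contrapT => H.
  have kd : 0 < kap * delta by rewrite mulr_gt0.
  have WT : 0 <= W T := le_trans (separable_cost_ge0 phi0 _) (W_ge T tT).
  (* If [D] stayed above [delta] up to this time, [W] would have dropped by [W T + 1] and become
     negative. *)
  pose b := T + (W T + 1) / (kap * delta).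
  have Tb : T <= b by rewrite lerDl divr_ge0 ?(ltW kd)// addr_ge0.
  have := Hdec T b delta tT Tb (ltW d0).
  have -> : kap * delta * (b - T) = W T + 1.
    by rewrite /b addrC addKr mulrC divfK// gt_eqF.
  have Wb : 0 <= W b := le_trans (separable_cost_ge0 phi0 _) (W_ge b (le_trans tT Tb)).
  have bad : forall t g, T < t < b -> clarke_gradient (separable_cost phi) (p t) g ->
      delta <= D g t.
    move=> t g /andP[Tt tb] gF; rewrite leNgt; apply/negP => Dd; apply: H.
    by exists t, g; split => //; exact: ltW.
  by move=> /(_ bad); lra.
have [B HB] := state_bounded.
pose M := \sum_(i < #|V|) (B + `|Q i 0|) ^+ 2.
have HM t : t0 <= t -> dot (dev (p t - Q)) (dev (p t - Q)) <= M.
  move=> tt; rewrite dot_dev.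
  apply: (@le_trans _ _ (dot (p t - Q) (p t - Q))).
    by rewrite gerBl divr_ge0// -expr2 sqr_ge0.
  apply: ler_sum => i _; rewrite -expr2 -real_normK ?num_real//.
  have h : `|(p t - Q) i 0| <= B + `|Q i 0|.
    rewrite mxE [(- Q) i 0]mxE; apply: (le_trans (ler_normB _ _)).
    by rewrite lerD2r; exact: HB.
  by rewrite ler_pXn2r ?nnegrE//; exact: le_trans h.
have M0 : 0 <= M by apply: sumr_ge0 => i _; exact: sqr_ge0.
(* The error [eta] is split into thirds: [c M] for the distance to [Q] in Young's inequality,
   [delta K1] for the small quantity [D], and [E K2] for the exponentially small terms. *)
pose c := eta / (3 * (M + 1)).
have c0 : 0 < c by rewrite divr_gt0// mulr_gt0// ltr_wpDl.
have cM : c * M <= eta / 3.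
  have -> : eta / 3 = c * (M + 1) by rewrite /c; field; rewrite gt_eqF// ltr_wpDl.
  by rewrite ler_pM2l//; lra.
pose K1 := (4 * c)^-1 + nu1 * nu2 / 2 + 1 / 2.
have K10 : 0 < K1.
  have h1 : 0 < (4 * c)^-1 by rewrite invr_gt0 mulr_gt0.
  have h2 : 0 < nu1 * nu2 / 2 by rewrite divr_gt0// mulr_gt0.
  by rewrite /K1; lra.
(* The summands come from mean of [g] times mismatch, from the mean of [z], and from the term [K E]
   of [W]. The bound [|mean g| <= C + 1] uses [delta <= 1]. *)
pose K2 := (C + 1) * C + nu2 / (2 * nu1) * C ^+ 2 + K + 1.
have K20 : 0 < K2.
  have h1 : 0 <= (C + 1) * C by rewrite mulr_ge0// addr_ge0.
  have h2 : 0 <= nu2 / (2 * nu1) * C ^+ 2.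
    by rewrite mulr_ge0 ?sqr_ge0// divr_ge0 ?mulr_ge0// ltW.
  by rewrite /K2; lra.
pose delta := Num.min 1 (eta / (3 * K1)).
have delta0 : 0 < delta by rewrite lt_min ltr01 divr_gt0// mulr_gt0.
have dK : delta * K1 <= eta / 3.
  have -> : eta / 3 = eta / (3 * K1) * K1 by field; rewrite gt_eqF.
  by rewrite ler_wpM2r ?(ltW K10)// ge_min lexx orbT.
have [T tT HT] := cE (eta / (3 * K2)) (divr_gt0 eta0 (mulr_gt0 (ltr0n R 3) K20)).
have [t [g [Tt gF Dd]]] := late delta T delta0 tT.
have tt := le_trans tT Tt.
exists t => // s ts; apply: (le_trans (W_ge s (le_trans tt ts))).
apply: (le_trans (W_dec t s tt ts)).
have [Et0 Et1 hp hz] := HE t tt.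
have EK : E t * K2 <= eta / 3.
  have -> : eta / 3 = eta / (3 * K2) * K2 by field; rewrite gt_eqF.
  by rewrite ler_wpM2r ?(ltW K20)//; exact: HT.
have Gd0 := dot_ge0 (dev g); have Zd0 := dot_ge0 (dev (zt t)); have X0 := dot_ge0 (xi t).
rewrite /D in Dd.
have Gdd : dot (dev g) (dev g) <= delta.
  by apply: le_trans (ltW Dd); rewrite -addrA lerDl addr_ge0.
have Zdd : dot (dev (zt t)) (dev (zt t)) <= delta.
  apply: le_trans (ltW Dd); rewrite [dot (dev g) _ + _]addrC -addrA lerDl.
  by rewrite addr_ge0.
have sq1 : Num.sqrt (dot (dev g) (dev g)) <= 1.
  rewrite -[leRHS]sqrtr1; apply: ler_wsqrtr.
  by apply: (le_trans Gdd); rewrite ge_min lexx.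
have sub := separable_cost_subgradient phi0 cphi (Q - p t) gF.
rewrite [p t + _]addrC subrK -opprB dotNr in sub.
(* As [Q] has total load [Pl], the mean of [g] meets only the mismatch, which is exponentially
   small. *)
have gpQ : dot g (p t - Q) = dot (dev (p t - Q)) (dev g) + mean g * (\sum_i p t i 0 - Pl).
  rewrite (dotC (dev _)) dot_dev /mean -Q1.
  have -> : \sum_i (p t - Q) i 0 = \sum_i p t i 0 - \sum_i Q i 0.
    by rewrite -sumrB; apply: eq_bigr => i _; rewrite !mxE.
  by ring.
have y := young_dot (dev (p t - Q)) (dev g) c0.
have cMt : c * dot (dev (p t - Q)) (dev (p t - Q)) <= c * M.
  by rewrite ler_pM2l//; exact: HM.
have mg : mean g * (\sum_i p t i 0 - Pl) <= (C + 1) * (C * E t).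
  apply: (le_trans (ler_norm _)); rewrite normrM; apply: ler_pM => //.
  by apply: (le_trans (Hm t g tt gF)); rewrite lerD2l.
have zz : nu1 * nu2 / 2 * dot (zt t) (zt t) <= nu1 * nu2 / 2 *
    dot (dev (zt t)) (dev (zt t)) + nu2 / (2 * nu1) * C ^+ 2 * E t.
  have n12 : 0 <= nu1 * nu2 / 2 by rewrite divr_ge0// mulr_ge0// ltW.
  have hs : nu1 ^+ 2 * (\sum_i zt t i 0) ^+ 2 <= C ^+ 2 * E t.
    rewrite -exprMn -real_normK ?num_real//.
    apply: (@le_trans _ _ ((C * E t) ^+ 2)).
      by rewrite ler_pXn2r ?nnegrE// mulr_ge0.
    by rewrite exprMn ler_wpM2l ?sqr_ge0// expr2 ler_piMl.
  have hs2 : (\sum_i zt t i 0) * (\sum_i zt t i 0) / #|V|%:R <= C ^+ 2 * E t / nu1 ^+ 2.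
    rewrite -expr2; apply: (@le_trans _ _ ((\sum_i zt t i 0) ^+ 2)).
      by rewrite ler_pdivrMr ?ltr0n// ler_peMr ?sqr_ge0// ler1n.
    by rewrite ler_pdivlMr ?exprn_gt0// mulrC.
  have := ler_wpM2l n12 hs2.
  have -> : nu1 * nu2 / 2 * (C ^+ 2 * E t / nu1 ^+ 2) = nu2 / (2 * nu1) * C ^+ 2 * E t.
    by field; rewrite gt_eqF.
  by rewrite dot_dev; lra.
have n12 : 0 < nu1 * nu2 / 2 by rewrite divr_gt0// mulr_gt0.
have c4 : 0 < (4 * c)^-1 by rewrite invr_gt0 mulr_gt0.
have d1 : (4 * c)^-1 * dot (dev g) (dev g) <= (4 * c)^-1 * delta.
  by rewrite ler_pM2l.
have d2 : nu1 * nu2 / 2 * dot (dev (zt t)) (dev (zt t)) <= nu1 * nu2 / 2 * delta.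
  by rewrite ler_pM2l.
rewrite WE; rewrite /K1 in dK; rewrite /K2 in EK.
by lra.
Qed.

End convergence.

(** * Penalized costs and projection onto a box with prescribed sum *)

Lemma pos_part_ge0 (R : realType) (u : R) : 0 <= pos_part u.
Proof. by rewrite le_max lexx. Qed.

Lemma pos_part_ge (R : realType) (u : R) : u <= pos_part u.
Proof. by rewrite le_max lexx orbT. Qed.

Lemma pos_part_convex (R : realType) (x y t : R) : 0 <= t -> t <= 1 ->
  pos_part (t * x + (1 - t) * y) <= t * pos_part x + (1 - t) * pos_part y.
Proof.
move=> t0 t1; have s0 : 0 <= 1 - t by rewrite subr_ge0.
rewrite {1}/pos_part ge_max; apply/andP; split.
  by rewrite addr_ge0// mulr_ge0// pos_part_ge0.
by rewrite lerD// ler_wpM2l// pos_part_ge.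
Qed.

Definition penalized (R : realType) (f : R -> R) (a b eps u : R) : R :=
  f u + 1 / eps * (pos_part (u - b) + pos_part (a - u)).

Lemma penalized_ge0 (R : realType) (f : R -> R) (a b eps u : R) :
  (forall u, 0 <= f u) -> 0 < eps -> 0 <= penalized f a b eps u.
Proof.
move=> f0 e0; rewrite addr_ge0// mulr_ge0 ?divr_ge0 ?(ltW e0)//.
by rewrite addr_ge0// pos_part_ge0.
Qed.

Lemma penalized_convex (R : realType) (f : R -> R) (a b eps : R) :
  convex_real f -> 0 < eps -> convex_real (penalized f a b eps).
Proof.
move=> cf e0 x y t t0 t1; rewrite /penalized.
have ie0 : 0 <= 1 / eps by rewrite divr_ge0// ltW.
have h1 := cf x y t t0 t1.
have h2 := pos_part_convex (x - b) (y - b) t0 t1.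
have h3 := pos_part_convex (a - x) (a - y) t0 t1.
have E2 : t * (x - b) + (1 - t) * (y - b) = t * x + (1 - t) * y - b by ring.
have E3 : t * (a - x) + (1 - t) * (a - y) = a - (t * x + (1 - t) * y) by ring.
rewrite E2 in h2; rewrite E3 in h3.
have := ler_wpM2l ie0 (lerD h2 h3); lra.
Qed.

(** The penalty times [eps] is the violation of the limits, and a point violating them by some
    amount is no farther than that from the interval. *)
Lemma penalized_coercive (R : realType) (f : R -> R) (a b eps u : R) :
  (forall u, 0 <= f u) -> 0 < eps ->
  `|u| <= eps * penalized f a b eps u + `|a| + `|b|.
Proof.
move=> f0 e0; rewrite /penalized mulrDr.
have -> : eps * (1 / eps * (pos_part (u - b) + pos_part (a - u))) =
   pos_part (u - b) + pos_part (a - u) by field; rewrite gt_eqF.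
have h0 : 0 <= eps * f u by rewrite mulr_ge0// ltW.
have h1 := pos_part_ge0 (u - b); have h2 := pos_part_ge (u - b).
have h3 := pos_part_ge0 (a - u); have h4 := pos_part_ge (a - u).
have := ler_norm a; have := ler_norm (- a); have := ler_norm b; have := ler_norm (- b).
rewrite !normrN => ? ? ? ?.
by rewrite ler_norml; apply/andP; split; lra.
Qed.

Lemma gradient_ed_cost (R : realType) (n : nat) (f : 'I_n -> R -> R)
    (V : {set 'I_n}) (x : 'cV[R]_#|V|) i :
  gradient (ed_cost f V) x i 0 = 'D_1 (f (enum_val i)) (x i 0).
Proof.
rewrite mxE /derive.
suff -> : (fun h : R => h^-1 *: ((ed_cost f V \o shift x) (h *: delta_mx i 0)
     - ed_cost f V x)) =
  (fun h : R => h^-1 *: ((f (enum_val i) \o shift (x i 0)) (h *: (1 : R))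
     - f (enum_val i) (x i 0))) by [].
apply/funext => h /=; congr (_ *: _).
rewrite /shift /ed_cost /= -[h *: 1]/(h * 1) mulr1.
rewrite (bigD1 i)//= [X in _ - X](bigD1 i)//= !mxE !eqxx mulr1.
rewrite (eq_bigr (fun j => f (enum_val j) (x j 0))).
  by ring.
by move=> j /negbTE ji; rewrite !mxE ji mulr0 add0r.
Qed.

(** The first hypothesis says that all coordinates move in the same direction from [y] to [T]. The
    1-norm of a partial move is then the change of the sum, and [theta] is chosen to reach the sum
    [s]. The last hypothesis covers a zero denominator. *)
Lemma segment_interpolation (R : realType) (m : nat) (y T : 'I_m -> R) (s : R) :
  \sum_i `|T i - y i| = `|\sum_i T i - \sum_i y i| ->
  0 <= (s - \sum_i y i) / (\sum_i T i - \sum_i y i) <= 1 ->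
  (\sum_i T i = \sum_i y i -> s = \sum_i y i) ->
  exists theta, [/\ 0 <= theta, theta <= 1,
    \sum_i (y i + theta * (T i - y i)) = s
    & \sum_i `|theta * (T i - y i)| = `|s - \sum_i y i|].
Proof.
move=> HT /andP[th0 th1] H0.
set theta := _ / _ in th0 th1; exists theta.
have E : theta * (\sum_i T i - \sum_i y i) = s - \sum_i y i.
  have [e0|e0] := eqVneq (\sum_i T i - \sum_i y i) 0; last by rewrite divfK.
  by rewrite e0 mulr0 H0 ?subrr//; apply/eqP; rewrite -subr_eq0 e0.
split => //.
  by rewrite big_split/= -mulr_sumr sumrB E addrC subrK.
rewrite (eq_bigr (fun i => theta * `|T i - y i|)) => [|i _]; last first.
  by rewrite normrM ger0_norm.
by rewrite -mulr_sumr HT -[theta in LHS]ger0_norm// -normrM E.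
Qed.

(** Clipping each coordinate costs the total violation. The lost sum is then restored by moving
    towards the corner [hi] or [lo]; by monotonicity this move costs the change of the sum, again at
    most the violation. *)
Lemma project_on_box (R : realType) (m : nat) (lo hi x : 'I_m -> R) :
  (forall i, lo i <= hi i) -> \sum_i lo i <= \sum_i x i <= \sum_i hi i ->
  exists y : 'I_m -> R, [/\ forall i, lo i <= y i <= hi i, \sum_i y i = \sum_i x i
   & \sum_i `|x i - y i| <=
     2 * \sum_i (pos_part (x i - hi i) + pos_part (lo i - x i))].
Proof.
move=> lohi /andP[los his].
pose a i := pos_part (x i - hi i); pose b i := pos_part (lo i - x i).
pose c i := x i - a i + b i.
have cb i : lo i <= c i <= hi i.
  rewrite /c /a /b /pos_part; have := lohi i.
  by case: (leP 0 (x i - hi i)); case: (leP 0 (lo i - x i)) => ? ? ?; apply/andP; split; lra.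
have xc i : `|x i - c i| <= a i + b i.
  rewrite /c (_ : x i - _ = a i - b i); last by ring.
  apply: (le_trans (ler_normB _ _)).
  by rewrite !ger0_norm ?pos_part_ge0.
have sc : \sum_i x i - \sum_i c i = \sum_i a i - \sum_i b i.
  by rewrite -!sumrB; apply: eq_bigr => i _; rewrite /c; ring.
have a0 : 0 <= \sum_i a i by apply: sumr_ge0 => i _; exact: pos_part_ge0.
have b0 : 0 <= \sum_i b i by apply: sumr_ge0 => i _; exact: pos_part_ge0.
suff [T [theta [Tb [th0 th1 s1 s2]]]] : exists T theta, (forall i, lo i <= T i <= hi i) /\
    [/\ 0 <= theta, theta <= 1, \sum_i (c i + theta * (T i - c i)) = \sum_i x i
    & \sum_i `|theta * (T i - c i)| = `|\sum_i x i - \sum_i c i|].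
  exists (fun i => c i + theta * (T i - c i)); split => //.
    move=> i; have /andP[c1 c2] := cb i; have /andP[T1 T2] := Tb i.
    have h1 : 0 <= theta * (T i - lo i) by rewrite mulr_ge0// subr_ge0.
    have h2 : 0 <= theta * (hi i - T i) by rewrite mulr_ge0// subr_ge0.
    have h3 : 0 <= (1 - theta) * (c i - lo i) by rewrite mulr_ge0// subr_ge0.
    have h4 : 0 <= (1 - theta) * (hi i - c i) by rewrite mulr_ge0// subr_ge0.
    by apply/andP; split; lra.
  apply: (@le_trans _ _ (\sum_i (a i + b i + `|theta * (T i - c i)|))).
    apply: ler_sum => i _; rewrite opprD addrA.
    by apply: (le_trans (ler_normB _ _)); rewrite lerD2r.
  rewrite big_split/= s2 sc big_split/=.
  have : `|\sum_i a i - \sum_i b i| <= \sum_i a i + \sum_i b i.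
    by rewrite ler_norml; apply/andP; split; lra.
  lra.
have [ab|ab] := leP (\sum_i c i) (\sum_i x i).
  exists hi; have ch i : 0 <= hi i - c i by rewrite subr_ge0; case/andP: (cb i).
  have cs : 0 <= \sum_i hi i - \sum_i c i by rewrite -sumrB sumr_ge0.
  have [|||theta H] := @segment_interpolation R m c hi (\sum_i x i).
  - by rewrite ger0_norm// -sumrB; apply: eq_bigr => i _; rewrite ger0_norm.
  - rewrite divr_ge0 ?subr_ge0//=; last by rewrite -subr_ge0.
    move: cs; rewrite le_eqVlt => /predU1P[<-|cs]; first by rewrite invr0 mulr0.
    by rewrite ler_pdivrMr// mul1r lerD2r.
  - by move=> e; apply/eqP; rewrite eq_le ab -e his.
  exists theta; split => // i; by rewrite lohi lexx.
exists lo; have ch i : lo i - c i <= 0 by rewrite subr_le0; case/andP: (cb i).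
have cs : \sum_i lo i - \sum_i c i <= 0 by rewrite -sumrB sumr_le0.
have [|||theta H] := @segment_interpolation R m c lo (\sum_i x i).
- by rewrite ler0_norm// -sumrB -sumrN; apply: eq_bigr => i _; rewrite ler0_norm.
- rewrite -mulrNN -invrN !opprB divr_ge0 ?subr_ge0 ?(ltW ab)//=; last by rewrite -subr_le0.
  move: cs; rewrite -oppr_ge0 opprB le_eqVlt => /predU1P[<-|cs].
    by rewrite invr0 mulr0.
  by rewrite ler_pdivrMr// mul1r lerD2l lerN2.
- by move=> e; move: ab; rewrite -e ltNge los.
exists theta; split => // i; by rewrite lohi lexx.
Qed.

(** * Exact penalty and the set of solutions *)

Lemma continuous_sum_coord (R : realType) (m : nat) :
  continuous (fun x : 'rV[R]_m => \sum_i x 0 i).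
Proof. by apply: continuous_sum => i; exact: coord_continuous. Qed.

Lemma closed_coord_itv (R : realType) (m : nat) (lo hi : 'I_m -> R) :
  closed [set x : 'rV[R]_m | forall i, lo i <= x 0 i <= hi i].
Proof.
rewrite (_ : [set x | _] = \bigcap_(i in [set: 'I_m])
    ((fun x : 'rV[R]_m => x 0 i) @^-1` `[lo i, hi i])).
  apply: closed_bigI => i _; apply: (@preimage_closed 'rV[R]_m R).
    by move=> x _; exact: coord_continuous.
  exact: interval_closed.
apply/seteqP; split => x /= H i; have := H i; rewrite /= in_itv//=; exact.
Qed.

Lemma closed_row_min (R : realType) (m : nat) (h : 'rV[R]_m -> R)
    (A : set 'rV[R]_m) (B : R) :
  continuous h -> closed A -> (forall x, A x -> forall i, `|x 0 i| <= B) ->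
  A !=set0 -> exists2 c, A c & forall x, A x -> h c <= h x.
Proof.
move=> ch cA bA A0.
have kA : compact A.
  apply: bounded_closed_compact => //.
  exists (Num.max 0 B); split; first exact: num_real.
  move=> y By x Ax; apply: mx_norm_le => [|i j].
    by apply: le_trans (ltW By); rewrite le_max lexx.
  rewrite (ord1 i); apply: (le_trans (bA x Ax j)); apply: le_trans (ltW By).
  by rewrite le_max lexx orbT.
have [c cA' Hc] := EVT_min_rV A0 kA (continuous_subspaceT ch).
by exists c => [|x Ax]; [exact: set_mem | apply: Hc; exact: mem_set].
Qed.

Lemma continuous_dist (R : realType) (W : normedModType R) (q : W) :
  continuous (fun x : W => `|x - q|).
Proof.
move=> x; apply/cvgrPdist_lt => d d0; apply/nbhs_ballP; exists d => //= y.
rewrite -ball_normE /= => xy; apply: le_lt_trans xy.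
apply: (le_trans (ler_dist_dist _ _)).
by rewrite opprB addrA subrK.
Qed.

Lemma closed_far_from (R : realType) (m : nat) (S : set 'rV[R]_m) (e : R) :
  closed [set x : 'rV[R]_m | forall q, S q -> e <= `|x - q|].
Proof.
rewrite (_ : [set x | _] = \bigcap_(q in S)
    ((fun x : 'rV[R]_m => `|x - q|) @^-1` [set y | e <= y])) //.
apply: closed_bigI => q _; apply: (@preimage_closed 'rV[R]_m R); last exact: closed_ge.
by move=> x _; exact: continuous_dist.
Qed.

Section economic_dispatch.
Variables (R : realType) (n : nat) (f : 'I_n -> R -> R) (Pm PM : 'I_n -> R).
Variables (Pl eps : R) (V : {set 'I_n}).
Hypotheses (hf : forall i, admissible_cost (f i)) (heps : 0 < eps).
Hypothesis hed : ed_assumptions f Pm PM Pl eps V.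

Let f0 i u : 0 <= f i u. Proof. by case: (hf i). Qed.
Let cf i : convex_real (f i). Proof. exact: admissible_convex_real. Qed.

(** With this form [penalized_cost] is a [separable_cost] by conversion. *)
Definition unit_cost (i : 'I_#|V|) : R -> R :=
  penalized (f (enum_val i)) (Pm (enum_val i)) (PM (enum_val i)) eps.

Lemma unit_cost_ge0 i u : 0 <= unit_cost i u.
Proof. exact: penalized_ge0. Qed.

Lemma unit_cost_convex i : convex_real (unit_cost i).
Proof. exact: penalized_convex. Qed.

Lemma unit_cost_coercive M : exists B : R, forall x,
  separable_cost unit_cost x <= M -> forall i, `|x i 0| <= B.
Proof.
exists (eps * M + \sum_(i < #|V|) (`|Pm (enum_val i)| + `|PM (enum_val i)| : R)) => x xM i.
apply: (le_trans (penalized_coercive (Pm (enum_val i)) (PM (enum_val i)) (x i 0)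
  (f0 (enum_val i)) heps)).
rewrite -addrA lerD//.
  rewrite ler_pM2l//; apply: le_trans xM.
  rewrite /separable_cost (bigD1 i)//= lerDl; apply: sumr_ge0 => j _.
  exact: unit_cost_ge0.
rewrite (bigD1 i)//= lerDl; apply: sumr_ge0 => j _.
by rewrite addr_ge0.
Qed.

Lemma ed_feasible_sum Q : ed_feasible Pm PM Pl V Q -> \sum_i Q i 0 = Pl.
Proof. by case; rewrite dotE dot_ones. Qed.

Lemma separable_cost_feasible Q : ed_feasible Pm PM Pl V Q ->
  separable_cost unit_cost Q = ed_cost f V Q.
Proof.
move=> [_ Hb]; apply: eq_bigr => i _; rewrite /unit_cost /penalized.
have /andP[h1 h2] := Hb i.
rewrite /pos_part !max_l ?subr_le0//.
by rewrite addr0 mulr0 addr0.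
Qed.

Lemma ed_limits_le i : i \in V -> Pm i <= PM i.
Proof.
move=> iV; have [[x [_ /(_ (enum_rank_in iV i)) H]] _ _ _] := hed.
by move: H; rewrite enum_rankK_in// => /andP[]; exact: le_trans.
Qed.

(** It makes the supremum in [ed_assumptions] a genuine upper bound. The derivative is a subgradient
    at a point of a bounded interval, so values of the cost at distance 1 outside bound it. *)
Lemma derive_bounded_on_feasible : exists C : R, forall Q i,
  ed_feasible Pm PM Pl V Q -> `|'D_1 (f (enum_val i)) (Q i 0)| <= C.
Proof.
pose B (i : 'I_#|V|) : R := `|Pm (enum_val i)| + `|PM (enum_val i)|.
exists (\sum_(i < #|V|) (f (enum_val i) (B i + 1) + f (enum_val i) (- B i - 1))).
move=> Q i [_ /(_ i) /andP[h1 h2]].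
have [_ _ df _] := hf (enum_val i).
have tan y := convex_real_tangent y (cf (enum_val i)) (df (Q i 0)).
have QB : Q i 0 <= B i.
  apply: (le_trans h2); apply: (le_trans (ler_norm _)); by rewrite lerDr.
have BQ : - B i <= Q i 0.
  apply: le_trans h1; rewrite lerNl; apply: (le_trans (ler_norm _)).
  by rewrite normrN lerDl.
have := subgradient_le (f0 (enum_val i)) tan QB.
have := subgradient_ge (f0 (enum_val i)) tan BQ.
have := f0 (enum_val i) (B i + 1); have := f0 (enum_val i) (- B i - 1).
have : f (enum_val i) (B i + 1) + f (enum_val i) (- B i - 1) <=
    \sum_(i < #|V|) (f (enum_val i) (B i + 1) + f (enum_val i) (- B i - 1)).
  rewrite [leRHS](bigD1 i)//= lerDl; apply: sumr_ge0 => j _.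
  by rewrite addr_ge0.
by move=> ? ? ? ? ?; rewrite ler_norml; apply/andP; split; lra.
Qed.

Lemma penalty_dominates_derivatives : exists D : R, [/\ 0 <= D, 2 * D < 1 / eps
  & forall Q i, ed_feasible Pm PM Pl V Q -> `|'D_1 (f (enum_val i)) (Q i 0)| <= D].
Proof.
have [[x fx] _ _ he] := hed.
set S := [set _ | _ in _] in he.
have [C HC] := derive_bounded_on_feasible.
have C0 : 0 <= Num.max 0 C by rewrite le_max lexx.
have ubS : has_ubound S.
  exists (Num.max 0 C) => _ [Q fQ <-].
  apply: mx_norm_le => // i j; rewrite (ord1 j) gradient_ed_cost.
  apply: (le_trans (HC Q i fQ)).
  by rewrite le_max lexx orbT.
have S_le Q : ed_feasible Pm PM Pl V Q -> `|gradient (ed_cost f V) Q| <= sup S.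
  by move=> fQ; apply: ub_le_sup => //; exists Q.
have D0 : 0 <= sup S by exact: le_trans (S_le x fx).
exists (sup S); split => //.
  (* When the supremum is 0 its inverse is [+oo], and the claim reduces to [0 < 1 / eps]. *)
  move: he; rewrite inver; case: ifPn => [/eqP ->|ne _].
    by rewrite divr_gt0.
  have {ne}D1 : 0 < 2 * sup S by rewrite lt_neqAle eq_sym ne mulr_ge0.
  have [_ _ _] := hed; rewrite -/S inver gt_eqF// lte_fin => he.
  by rewrite div1r -(invrK (2 * sup S)) ltf_pV2// posrE// invr_gt0.
move=> Q i fQ; apply: le_trans (S_le Q fQ).
rewrite -gradient_ed_cost; exact: ler_mx_norm_coord.
Qed.

(* Moving an allocation P of total load Pl into the box changes it by at most
   twice its total limit violation in the 1-norm, and the penalty slope 1 / eps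
   exceeds twice the slopes of the costs at feasible points. *)
Lemma exact_penalty (x : 'cV[R]_#|V|) : \sum_i x i 0 = Pl -> ~ ed_feasible Pm PM Pl V x ->
  exists2 Q, ed_feasible Pm PM Pl V Q & ed_cost f V Q < separable_cost unit_cost x.
Proof.
move=> xPl nfx.
have [D [D0 De HD]] := penalty_dominates_derivatives.
have [[w fw] _ _ _] := hed.
have wPl := ed_feasible_sum fw; have [_ wb] := fw.
pose lo (i : 'I_#|V|) := Pm (enum_val i); pose hi (i : 'I_#|V|) := PM (enum_val i).
have lohi i : lo i <= hi i by apply: ed_limits_le; exact: enum_valP.
have xb : \sum_i lo i <= \sum_i x i 0 <= \sum_i hi i.
  rewrite xPl -wPl; apply/andP; split; apply: ler_sum => i _; by case/andP: (wb i).
have [y [yb ys yx]] := project_on_box lohi xb.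
pose Q : 'cV[R]_#|V| := \col_i y i.
have fQ : ed_feasible Pm PM Pl V Q.
  split; last by move=> i; rewrite mxE; exact: yb.
  by rewrite dotE dot_ones -xPl -ys; apply: eq_bigr => i _; rewrite mxE.
exists Q => //.
set viol := \sum_i (pos_part _ + pos_part _) in yx.
have viol0 : 0 < viol.
  rewrite lt_neqAle sumr_ge0 ?andbT; last by move=> i _; rewrite addr_ge0// pos_part_ge0.
  apply/eqP => v0; apply: nfx; split; first by rewrite dotE dot_ones.
  move=> i.
  have h0 j : 0 <= pos_part (x j 0 - hi j) + pos_part (lo j - x j 0).
    by rewrite addr_ge0// pos_part_ge0.
  have := psumr_eq0P (fun j _ => h0 j) (esym v0).
  move=> /(_ i isT).
  have := pos_part_ge0 (x i 0 - hi i); have := pos_part_ge (x i 0 - hi i).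
  have := pos_part_ge0 (lo i - x i 0); have := pos_part_ge (lo i - x i 0).
  by rewrite /lo /hi => ? ? ? ? ?; apply/andP; split; lra.
(* The tangent is taken at the projected point, where feasibility gives the derivative bound [D]. *)
have tan i : f (enum_val i) (y i) - f (enum_val i) (x i 0) <= D * `|x i 0 - y i|.
  have [_ _ df _] := hf (enum_val i).
  have := convex_real_tangent (x i 0) (cf (enum_val i)) (df (y i)).
  have := HD Q i fQ; rewrite mxE => HDi.
  have : - ('D_1 (f (enum_val i)) (y i) * (x i 0 - y i)) <= D * `|x i 0 - y i|.
    apply: (le_trans (ler_norm _)); rewrite normrN normrM.
    by rewrite ler_wpM2r.
  by lra.
have : ed_cost f V Q - \sum_i f (enum_val i) (x i 0) <= D * (2 * viol).
  apply: (@le_trans _ _ (\sum_i D * `|x i 0 - y i|)).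
    rewrite /ed_cost -sumrB; apply: ler_sum => i _; rewrite mxE; exact: tan.
  by rewrite -mulr_sumr ler_wpM2l.
have -> : separable_cost unit_cost x = \sum_i f (enum_val i) (x i 0) + 1 / eps * viol.
  by rewrite /separable_cost big_split/= -mulr_sumr.
have := ltr_pM2r viol0 (2 * D) (1 / eps); rewrite De.
by move=> h h2; lra.
Qed.

Lemma continuous_row_cost (phi : 'I_#|V| -> R -> R) :
  (forall i u, 0 <= phi i u) -> (forall i, convex_real (phi i)) ->
  continuous (fun x : 'rV[R]_#|V| => separable_cost phi x^T).
Proof.
move=> phi0 cphi.
rewrite (_ : (fun _ => _) = fun x : 'rV[R]_#|V| => \sum_i phi i (x 0 i)); last first.
  by apply/funext => x; apply: eq_bigr => i _; rewrite mxE.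
apply: continuous_sum => i x.
apply: (@continuous_comp 'rV[R]_#|V| R R (fun x => x 0 i) (phi i)).
  exact: coord_continuous.
exact: convex_real_continuous.
Qed.

Lemma ed_solution_exists : exists Q, ed_solutions f Pm PM Pl V Q.
Proof.
pose A := [set x : 'rV[R]_#|V| | ed_feasible Pm PM Pl V x^T].
have AE : A = [set x : 'rV[R]_#|V| | \sum_i x 0 i = Pl] `&`
    [set x : 'rV[R]_#|V| | forall i, Pm (enum_val i) <= x 0 i <= PM (enum_val i)].
  apply/seteqP; split => x [h1 h2]; split => /=.
  - by rewrite -h1 dotE dot_ones; apply: eq_bigr => i _; rewrite mxE.
  - by move=> i; have := h2 i; rewrite mxE.
  - by rewrite dotE dot_ones -h1; apply: eq_bigr => i _; rewrite mxE.
  - by move=> i; rewrite mxE.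
have cA : closed A.
  rewrite AE; apply: closedI; last exact: closed_coord_itv.
  apply: (@preimage_closed 'rV[R]_#|V| R (fun x => \sum_i x 0 i) [set y | y = Pl]).
    by move=> x _; exact: continuous_sum_coord.
  exact: closed_eq.
have bA x : A x -> forall i, `|x 0 i| <=
    \sum_(j < #|V|) (`|Pm (enum_val j)| + `|PM (enum_val j)| : R).
  move=> [_ h2] i; have := h2 i; rewrite mxE => /andP[h3 h4].
  apply: (@le_trans _ _ (`|Pm (enum_val i)| + `|PM (enum_val i)|)).
    have := ler_norm (PM (enum_val i)); have := ler_norm (- Pm (enum_val i)).
    have := normr_ge0 (PM (enum_val i)); have := normr_ge0 (Pm (enum_val i)).
    by rewrite normrN => ? ? ? ?; rewrite ler_norml; apply/andP; split; lra.
  rewrite [leRHS](bigD1 i)//= lerDl; apply: sumr_ge0 => j _.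
  by rewrite addr_ge0.
have A0 : A !=set0.
  have [[x fx] _ _ _] := hed; exists x^T; by rewrite /A/= trmxK.
pose phi (i : 'I_#|V|) : R -> R := f (enum_val i).
have cph : continuous (fun x : 'rV[R]_#|V| => separable_cost phi x^T).
  by apply: continuous_row_cost => *; [exact: f0 | exact: cf].
have [c Ac Hc] := closed_row_min cph cA bA A0.
exists c^T; split => // Q fQ.
by have := Hc Q^T; rewrite /A/= trmxK; exact.
Qed.

(** On the compact set of bounded points at distance at least [e] from the solutions, the larger of
    the mismatch and the excess cost is continuous and, by exactness of the penalty, positive. Its
    minimum serves as [gamma]. *)
Lemma near_solutions (B e : R) : 0 < e -> exists2 gamma : R, 0 < gamma &
  forall x : 'cV[R]_#|V|, (forall i, `|x i 0| <= B) ->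
    `|\sum_i x i 0 - Pl| < gamma ->
    (forall Q, ed_solutions f Pm PM Pl V Q ->
       separable_cost unit_cost x < separable_cost unit_cost Q + gamma) ->
    exists2 Q, ed_solutions f Pm PM Pl V Q & `|x - Q| < e.
Proof.
move=> e0; have [Q0 sQ0] := ed_solution_exists.
pose fs := separable_cost unit_cost Q0.
pose far := [set x : 'rV[R]_#|V| | forall q, [set q | ed_solutions f Pm PM Pl V q^T] q ->
  e <= `|x - q|].
pose A := far `&` [set x : 'rV[R]_#|V| | forall i, - B <= x 0 i <= B].
have cA : closed A.
  by apply: closedI; [exact: closed_far_from | exact: closed_coord_itv].
pose h1 (x : 'rV[R]_#|V|) := \sum_i x 0 i - Pl.
pose h2 (x : 'rV[R]_#|V|) := separable_cost unit_cost x^T - fs.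
pose h x := Num.max `|h1 x| (h2 x).
have subC (g : 'rV[R]_#|V| -> R) c : continuous g -> continuous (fun x => g x - c).
  move=> cg x; apply: (@continuous_comp 'rV[R]_#|V| R R g (fun y => y - c)); first exact: cg.
  by apply: cvgB; [exact: cvg_id | exact: cvg_cst].
have ch1 : continuous h1 by apply: subC; exact: continuous_sum_coord.
have ch2 : continuous h2.
  by apply: subC; apply: continuous_row_cost; [exact: unit_cost_ge0 | exact: unit_cost_convex].
have ch1n : continuous (fun x => `|h1 x|).
  move=> x; apply: (@continuous_comp 'rV[R]_#|V| R R h1 Num.norm); first exact: ch1.
  exact: norm_continuous.
have ch : continuous h.
  by move=> x; apply: (@continuous_max R 'rV[R]_#|V|); [exact: ch1n | exact: ch2].
have hpos x : A x -> 0 < h x.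
  move=> [farx _]; rewrite /h lt_max.
  have [s0|s0] := eqVneq (h1 x) 0; last by rewrite normr_gt0 s0.
  apply/orP; right; rewrite /h2 subr_gt0 ltNge; apply/negP => le_fs.
  have xPl : \sum_i x^T i 0 = Pl.
    move/eqP: s0; rewrite subr_eq0 => /eqP <-.
    by apply: eq_bigr => i _; rewrite mxE.
  have [fx|nfx] := pselect (ed_feasible Pm PM Pl V x^T); last first.
    have [Q fQ Qx] := exact_penalty xPl nfx.
    have [fQ0 /(_ Q fQ)] := sQ0.
    by rewrite -(separable_cost_feasible fQ0) leNgt (lt_le_trans Qx).
  have sx : ed_solutions f Pm PM Pl V x^T.
    split => // Q fQ; have [fQ0 /(_ Q fQ)] := sQ0.
    rewrite -(separable_cost_feasible fQ0) -(separable_cost_feasible fx).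
    exact: le_trans.
  by have := farx x sx; rewrite subrr normr0 leNgt e0.
have [gamma g0 Hg] : exists2 gamma, 0 < gamma & forall x, A x -> gamma <= h x.
  have [A0|nA0] := pselect (A !=set0); last first.
    by exists 1 => // x Ax; exfalso; apply: nA0; exists x.
  have [|c Ac Hc] := @closed_row_min R #|V| h A B ch cA _ A0.
    by move=> x [_ bx] i; rewrite ler_norml; exact: bx.
  by exists (h c); [exact: hpos | exact: Hc].
exists gamma => // x xB xs xc.
apply: contrapT => /forall2NP H.
have Ax : A x^T.
  split; last by move=> i /=; rewrite mxE -ler_norml.
  move=> q /= sq; have [//|/negP] := H q^T; rewrite -leNgt.
  have -> : x - q^T = (x^T - q)^T by rewrite linearB /= trmxK.
  by rewrite mx_norm_trmx.
have := Hg _ Ax; rewrite leNgt => /negP; apply.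
rewrite /h gt_max; apply/andP; split.
  rewrite /h1 (eq_bigr (fun i => x i 0))// => i _; by rewrite mxE.
by rewrite /h2 trmxK ltrBlDl; exact: xc.
Qed.

End economic_dispatch.

(** * Switching *)

Section switching.
Variables (R : realType) (n : nat).
Variables (F : forall V : {set 'I_n}, 'cV[R]_#|V| -> R).
Variables (Pl alpha beta nu1 nu2 : R).
Variables (sigma : R -> wdigraph R n) (N : option nat) (tau : nat -> R).
Variables (G : nat -> wdigraph R n) (r : nat -> 'I_n).
Variables (P z v : nat -> R -> 'I_n -> R).
Hypothesis hsigma : switching_signal sigma N tau G.
Hypothesis hr : forall k t, in_phase N tau k t -> r k \in vertices (sigma t).
Hypothesis hsol : solves_dynamics F Pl alpha beta nu1 nu2 sigma N tau G r P z v.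
Hypothesis hroutine : trajectory_invariance N tau G P z v.
Hypothesis hv0 : sum_units (vertices (G 0%N)) (v 0%N 0) = 0.

Lemma occursS k : occurs N k.+1 -> occurs N k.
Proof. by case: N => [m|]//=; exact: ltnW. Qed.

Lemma tau_ge0 k : occurs N k -> 0 <= tau k.
Proof.
elim: k => [_|k IH okS]; first by rewrite (tau_start hsigma).
exact: le_trans (IH (occursS okS)) (tau_monotone hsigma okS).
Qed.

Lemma phase_network k t : in_phase N tau k t ->
  [/\ sigma t = G k, weight_balanced (G k), strongly_connected (G k)
    & r k \in vertices (G k)].
Proof.
move=> kt; have sE := signal_constant hsigma kt.
have t0 : 0 <= t by case/and3P: kt => ok kt _; exact: le_trans (tau_ge0 ok) kt.
by have := hr kt; rewrite -sE; split => //;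
  [exact: signal_balanced hsigma t t0 | exact: signal_strong hsigma t t0].
Qed.

Lemma phase_dynamics k T : occurs N k -> (occurs N k.+1 -> T <= tau k.+1) ->
  {ae (@lebesgue_measure R), forall t, tau k < t < T ->
    dynamics_at F Pl alpha beta nu1 nu2 (G k) (r k) (P k) (z k) (v k) t}.
Proof.
move=> ok kT; apply: (ae_imp _ (solution_ae hsol k)) => t Ht /andP[kt tT].
have kph : in_phase N tau k t.
  by rewrite /in_phase ok ltW//=; apply/implyP => /kT; exact: lt_le_trans.
by have [sE _ _ _] := phase_network kph; have := Ht kph; rewrite sE.
Qed.

Lemma sum_v_phase k T : in_phase N tau k (tau k) -> in_closed_phase N tau k T ->
  sum_units (vertices (G k)) (v k T) = sum_units (vertices (G k)) (v k (tau k)).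
Proof.
move=> kk /[dup] kT /and3P[ok tT /implyP oS].
have [_ balG _ rG] := phase_network kk.
have [_ _ acv] := solution_ac hsol kT.
exact: (phase_sum_v balG rG tT acv (phase_dynamics ok oS)).
Qed.

(** The sum is conserved within a phase; a joining unit brings 0, and a leaving unit hands its value
    to a unit that stays. *)
Lemma sum_v_eq0 k : occurs N k -> sum_units (vertices (G k)) (v k (tau k)) = 0.
Proof.
elim: k => [_|k IH okS]; first by rewrite (tau_start hsigma).
have ok := occursS okS.
have {IH} vk : sum_units (vertices (G k)) (v k (tau k.+1)) = 0.
  have tS := tau_monotone hsigma okS.
  (* A phase reduced to a point is set apart: its network need not be weight-balanced, but no time
     elapses. *)
  move: (tS); rewrite le_eqVlt => /predU1P[<-|lt]; first exact: IH.
  rewrite -(IH ok); apply: sum_v_phase.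
    by rewrite /in_phase ok lexx lt implybT.
  by rewrite /in_closed_phase ok tS lexx implybT.
rewrite sum_units_in in vk; rewrite sum_units_in.
have [Hadd Hdel] := hroutine okS.
case: (signal_event hsigma okS) => -[i ei].
  have [vi Hl] := Hadd i ei; have [iG VE _] := ei.
  rewrite VE big_setU1//= vi add0r -[RHS]vk; apply: eq_bigr => l lG.
  by have [] := Hl l lG.
have [j [ji eji Hl]] := Hdel i ei; have [iG VE _] := ei.
have jG : j \in vertices (G k) by have /andP[] := adj_vertices eji.
have jV : j \in vertices (G k.+1) by rewrite VE !inE ji.
rewrite -[RHS]vk (bigD1 j jV)/= [RHS](big_setD1 i)//= -VE [X in _ = _ + X](bigD1 j jV)/=.
have [_ _ ->] := Hl j jV; rewrite eqxx addrA [_ + v k _ i]addrC.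
congr (_ + _); apply: eq_bigr => l /andP[lV /negbTE lj].
by have [_ _ ->] := Hl l lV; rewrite lj.
Qed.

End switching.

Lemma sqrt_sum_sqr_le (R : realType) (a b : R) :
  Num.sqrt (a ^+ 2 + b ^+ 2) <= `|a| + `|b|.
Proof.
have ab : 0 <= `|a| + `|b| by rewrite addr_ge0.
rewrite -[leRHS]ger0_norm// -sqrtr_sqr; apply: ler_wsqrtr.
rewrite sqrrD !real_normK ?num_real//.
have : 0 <= `|a| * `|b| by rewrite mulr_ge0.
lra.
Qed.

Lemma edist_inf_cvg0 (R : realType) (W : normedModType R) (S : set W) (x : R -> W) :
  (forall e, 0 < e -> exists T, forall t, T <= t -> exists2 q, S q & `|x t - q| < e) ->
  edist_inf S (x t) @[t --> +oo] --> (0 : \bar R).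
Proof.
move=> H.
have near_le e : 0 < e -> \forall t \near +oo, (edist_inf S (x t) <= e%:E)%E.
  move=> e0; have [T HT] := H e e0.
  exists T; split; first exact: num_real.
  move=> t /ltW /HT[q Sq xq].
  apply: (@le_trans _ _ (edist (x t, q))).
    by apply: ereal_inf_lbound; exists q.
  by apply: edist_fin => //; rewrite -ball_normE.
apply/fine_cvgP; split.
  apply: filterS (near_le 1 ltr01) => t t1.
  by rewrite ge0_fin_numE ?edist_inf_ge0// (le_lt_trans t1)// ltey.
apply/cvgrPdist_le => e e0; apply: filterS (near_le e e0) => t te.
rewrite sub0r normrN /= ger0_norm ?fine_ge0 ?edist_inf_ge0//.
rewrite -lee_fin fineK//.
by rewrite ge0_fin_numE ?edist_inf_ge0// (le_lt_trans te)// ltey.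
Qed.

Unset Implicit Arguments.
Set Strict Implicit.
Set Printing Implicit Defensive.

Theorem proposition5p7 (R : realType) (nmax : nat)
    (f : 'I_nmax -> R -> R) (Pm PM : 'I_nmax -> R) (Pl eps : R)
    (alpha beta nu1 nu2 : R)
    (sigma : R -> wdigraph R nmax) (N : option nat) (tau : nat -> R)
    (G : nat -> wdigraph R nmax) (r : nat -> 'I_nmax)
    (P z v : nat -> R -> 'I_nmax -> R)
    (hf : forall i, admissible_cost (f i))
    (hPl : 0 < Pl) (heps : 0 < eps)
    (halpha : 0 < alpha) (hbeta : 0 < beta) (hnu1 : 0 < nu1) (hnu2 : 0 < nu2)
    (hsigma : switching_signal sigma N tau G)
    (hr : forall k t, in_phase N tau k t -> r k \in vertices (sigma t))
    (hed : forall t, 0 <= t ->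
       ed_assumptions f Pm PM Pl eps (vertices (sigma t)))
    (hsol : solves_dynamics (penalized_cost f Pm PM eps)
              Pl alpha beta nu1 nu2 sigma N tau G r P z v)
    (hroutine : trajectory_invariance N tau G P z v)
    (hv0 : sum_units (vertices (G 0%N)) (v 0%N 0) = 0) :
  (forall (k : nat) (M1 M2 rho : R),
     let t := tau k in
     let V := vertices (sigma t) in
     let Rmx := mismatch_matrix alpha nu1 nu2 in
     let c1 := Num.sqrt (lambda_max Rmx / lambda_min Rmx) in
     let c2 := 1 / (2 * lambda_max Rmx) in
     let trho := 1 / c2 * ln (c1 * (M1 + nu1 * M2) / rho) in
     (* k is the last of the events occurring at time t *)
     in_phase N tau k t ->
     0 < M1 -> 0 < M2 -> 0 < rho ->
     `|sum_units V (P k t) - Pl| <= M1 ->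
     `|sum_units V (z k t)| <= M2 ->
     (forall l, (0 < l)%N -> occurs N l -> ~~ (t < tau l < t + trho)) ->
     (* trho <= 0 means that the bound holds at time t already *)
     `|sum_units V (P k (t + Num.max 0 trho)) - Pl| <= rho)
  /\
  (forall m : nat, N = Some m ->
     let V := vertices (sigma (tau m)) in
     let L := laplacian (sigma (tau m)) in
     let lambda2 := lambda_two (L + L^T) in
     nu1 / (beta * nu2 * lambda2) + nu2 ^+ 2 * lambda_max (L^T *m L) / (2 * alpha)
       < lambda2 ->
     edist_inf (ed_solutions f Pm PM Pl V) (restr V (P m t))
       @[t --> +oo] --> (0 : \bar R)).
Proof.
split.
  move=> k M1 M2 rho t V Rmx c1 c2 trho kt M10 M20 rho0 hP hz hev.
  have [sE balG _ rG] := phase_network hsigma hr kt.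
  have /and3P[ok _ /implyP kS] := kt.
  pose T := t + Num.max 0 trho.
  have tT : t <= T by rewrite lerDl le_max lexx.
  (* An earlier next event would fall in the excluded open interval or, when [trho <= 0], contradict
     that [k] is the last event at time [t]. *)
  have TS : occurs N k.+1 -> T <= tau k.+1.
    move=> okS; have tS := kS okS; rewrite leNgt; apply/negP => ST.
    have /negP := hev k.+1 isT okS; apply; rewrite tS/=.
    move: ST; rewrite /T; case: (leP 0 trho) => // _; rewrite addr0 => /lt_trans /(_ tS).
    by rewrite ltxx.
  have kT : in_closed_phase N tau k T.
    by rewrite /in_closed_phase ok tT/=; exact/implyP.
  have [acP acz acv] := solution_ac hsol kT.
  have v0 := sum_v_eq0 hsigma hr hsol hroutine hv0 ok.
  have := phase_mismatch halpha hnu1 hnu2 balG rG tT acP acz acv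
    (phase_dynamics hsigma hr hsol ok TS) v0.
  rewrite /V sE in hP hz *; rewrite -/Rmx -/c1 -/c2 => H.
  apply: (@le_trans _ _ (Num.sqrt ((sum_units (vertices (G k)) (P k T) - Pl) ^+ 2 +
    (nu1 * sum_units (vertices (G k)) (z k T)) ^+ 2))).
    by rewrite -sqrtr_sqr; apply: ler_wsqrtr; rewrite lerDl sqr_ge0.
  apply: (le_trans H).
  have lM := lambda_max_mismatch_gt0 halpha hnu1 hnu2; rewrite -/Rmx in lM.
  have lm := lambda_min_mismatch_gt0 halpha hnu1 hnu2; rewrite -/Rmx in lm.
  have c10 : 0 < c1 by rewrite sqrtr_gt0 divr_gt0.
  have c20 : 0 < c2 by rewrite divr_gt0// mulr_gt0.
  have M0 : 0 < M1 + nu1 * M2 by rewrite addr_gt0// mulr_gt0.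
  have cM0 : 0 < c1 * (M1 + nu1 * M2) / rho by rewrite divr_gt0// mulr_gt0.
  have eT : expR (- c2 * (T - t)) <= rho / (c1 * (M1 + nu1 * M2)).
    rewrite -[leRHS]invrK invf_div -(lnK cM0) -expRN ler_expR mulNr lerN2.
    rewrite /T [t + _]addrC addrK.
    have -> : ln (c1 * (M1 + nu1 * M2) / rho) = c2 * trho.
      by rewrite /trho div1r mulVKf// gt_eqF.
    by rewrite ler_pM2l// le_max lexx orbT.
  have -> : rho = c1 * (rho / (c1 * (M1 + nu1 * M2))) * (M1 + nu1 * M2).
    by field; rewrite !gt_eqF.
  apply: ler_pM.
  - by rewrite mulr_ge0 ?expR_ge0// ltW.
  - exact: sqrtr_ge0.
  - by rewrite ler_pM2l.
  (* The decay estimate involves the Euclidean norm of the initial pair, here bounded by the sum of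
     absolute values [M1 + nu1 * M2]. *)
  apply: (le_trans (sqrt_sum_sqr_le _ _)); apply: lerD => //.
  by rewrite normrM gtr0_norm// ler_pM2l.
move=> m Nm.
have mm : in_phase N tau m (tau m).
  by rewrite /in_phase Nm /= leqnn lexx ltnn.
have /and3P[om _ _] := mm.
have oS : occurs N m.+1 = false by rewrite Nm /= ltnn.
have [sE balG conG rG] := phase_network hsigma hr mm.
have hedm := hed _ (tau_ge0 hsigma om).
rewrite sE in hedm *.
move=> V L lambda2 gains.
have clT T : tau m <= T -> in_closed_phase N tau m T.
  by move=> mT; rewrite /in_closed_phase om mT oS.
have acP T : tau m <= T -> abs_continuous (tau m) T (fun s => restr V (P m s)).
  by move=> /clT /(solution_ac hsol)[].
have acz T : tau m <= T -> abs_continuous (tau m) T (fun s => restr V (z m s)).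
  by move=> /clT /(solution_ac hsol)[].
have acv T : tau m <= T -> abs_continuous (tau m) T (fun s => restr V (v m s)).
  by move=> /clT /(solution_ac hsol)[].
have aed : {ae (@lebesgue_measure R), forall t, tau m < t -> dynamics_at
    (penalized_cost f Pm PM eps) Pl alpha beta nu1 nu2 (G m) (r m) (P m) (z m) (v m) t}.
  apply: (ae_imp _ (solution_ae hsol m)) => t Ht mt.
  have mph : in_phase N tau m t by rewrite /in_phase om ltW// oS.
  by have [tE _ _ _] := phase_network hsigma hr mph; have := Ht mph; rewrite tE.
have v0 := sum_v_eq0 hsigma hr hsol hroutine hv0 om.
have phi0 := @unit_cost_ge0 R nmax f Pm PM eps V hf heps.
have cphi := @unit_cost_convex R nmax f Pm PM eps V hf heps.
have coer := @unit_cost_coercive R nmax f Pm PM eps V hf heps.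
have FE : penalized_cost f Pm PM eps V = separable_cost (unit_cost f Pm PM eps (V := V)).
  by [].
have [Q sQ] := ed_solution_exists hf hedm.
have QPl := ed_feasible_sum sQ.1.
apply: edist_inf_cvg0 => e e0.
have [B HB] := state_bounded balG conG rG phi0 cphi coer FE halpha hbeta hnu1 hnu2
  gains acP acz acv aed v0.
have [gamma g0 Hg] := near_solutions hf heps hedm B e0.
(* Halving [gamma] turns the nonstrict estimates into the strict ones required. All solutions have
   the same cost, so the estimate for the single [Q] serves for every [Q']. *)
have g2 : 0 < gamma / 2 by rewrite divr_gt0.
have [T1 mT1 HT1] := mismatch_cvg0 balG conG rG phi0 cphi FE halpha hbeta hnu1 hnu2
  gains acP acz acv aed v0 g2.
have [T2 mT2 HT2] := cost_limsup balG conG rG phi0 cphi coer FE halpha hbeta hnu1 hnu2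
  gains acP acz acv aed v0 QPl g2.
exists (Num.max T1 T2) => t; rewrite ge_max => /andP[T1t T2t].
apply: Hg.
- exact: HB (le_trans mT1 T1t).
- by apply: le_lt_trans (HT1 t T1t) _; lra.
move=> Q' sQ'; apply: (le_lt_trans (HT2 t T2t)).
rewrite (separable_cost_feasible f eps sQ.1) (separable_cost_feasible f eps sQ'.1).
have := sQ.2 _ sQ'.1; lra.
Qed.
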